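(* Let $\mu=(\mu_1,\mu_2)$ be a two-row partition of $n$. The polynomials $$\mathcal{C}_\mu:=\{F_T^S : S\in\Sigma_\mu,\ T\in\mathrm{SYT}_n,\ \mathrm{sh}(S)=\mathrm{sh}(T)\}$$ form a higher Specht basis for the Garsia–Procesi module $R_\mu$.
   Context: ''Higher Specht basis of $R_\mu$'' means: the listed polynomials descend to a $\mathbb{Q}$-basis of $R_\mu$, and for each fixed $S$ the images of the $F_T^S$, $T\in\mathrm{SYT}(\mathrm{sh}(S))$, span a copy of the irreducible $\mathfrak{S}_n$-representation (Specht module) $V_{\mathrm{sh}(S)}$, where $\mathfrak{S}_n$ permutes the variables. Garsia–Procesi module: let $\mu'=(\mu'_1\ge\dots\ge\mu'_n\ge0)$ be the transpose of $\mu\vdash n$ padded with zeros. $R_\mu=\mathbb{Q}[x_1,\dots,x_n]/I_\mu$, where $I_\mu$ is generated by all $e_d(A)$ with $A\subseteq\{x_1,\dots,x_n\}$ and $d>|A|-(\mu'_n+\dots+\mu'_{n-|A|+1})$; here $e_d(A)$ is the sum of all squarefree degree-$d$ monomials in the variables of $A$. Tableaux are in French notation (first row at the bottom). $\mathrm{SYT}_n$ is the set of standard Young tableaux of size $n$ of any partition shape, $\mathrm{SYT}(\rho)$ those of shape $\rho$, $\mathrm{sh}$ denotes shape. The reading word $\mathrm{rw}(S)$ concatenates rows from top to bottom, each read left to right. Cocharge: for a permutation $w$, label the letter $1$ by $0$; if $i$ has label $c$, label $i+1$ by $c$ if it is to the right of $i$ in $w$ and by $c+1$ if to the left; the word of labels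 is $\mathrm{cc}(w)$. For $S\in\mathrm{SYT}_n$, $\mathrm{cc}(S)$ is the filling of $\mathrm{sh}(S)$ obtained by replacing each entry $i$ by its label in $\mathrm{rw}(S)$. Higher Specht polynomials: for $S,T\in\mathrm{SYT}(\rho)$, $\mathbf{x}_T^{\mathrm{cc}(S)}=\prod_{u\in\rho}x_{T(u)}^{\mathrm{cc}(S)(u)}$, $\varepsilon_T=\sum_{\tau\in C(T)}\sum_{\sigma\in R(T)}\mathrm{sgn}(\tau)\,\tau\sigma$ with $C(T),R(T)\subset\mathfrak{S}_n$ the column and row stabilizers of $T$, and $F_T^S=\varepsilon_T\cdot\mathbf{x}_T^{\mathrm{cc}(S)}$. Catabolizability type: on pairs $(x,\nu)$, where $x=ya$ is a nonempty word of nonnegative integers with last letter $a$ and $\nu$ is a partition, let $f(x,\nu)=(y,\nu+\epsilon_{a+1})$ if $\nu+\epsilon_{a+1}$ is a partition, and $f(x,\nu)=((a+1)y,\nu)$ otherwise ($\epsilon_j$ the $j$th unit vector; $(a+1)y$ is $y$ preceded by the letter $a+1$). Starting from $(\mathrm{cc}(w),\emptyset)$, apply $f$ until reaching $(\emptyset,\nu)$; then $\mathrm{ctype}(w)=\nu$, and $\mathrm{ctype}(S)=\mathrm{ctype}(\mathrm{rw}(S))$. $\Sigma_\mu=\{S\in\mathrm{SYT}_n:\mathrm{ctype}(S)\trianglerighteq\mu\}$, where $\trianglerighteq$ is dominance order. *)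

(* Defs.v *)
From HB Require Import structures.
From mathcomp Require Import all_boot all_order all_algebra perm.
From mathcomp Require Import zify boolp.
From mathcomp Require Import mpoly.

Set Implicit Arguments.
Unset Strict Implicit.
Unset Printing Implicit Defensive.

Import GRing.Theory.

Local Open Scope ring_scope.
Local Open Scope quotient_scope.

(** * Partitions *)

Definition is_partition (nu : seq nat) : bool :=
  sorted geq nu && (0%N \notin nu).

(* The (j+1)-st part of the transpose; trailing zeros of [mu] are harmless. *)
Definition conj_part (mu : seq nat) (j : nat) : nat :=
  count (fun m => j < m)%N mu.

(* Partial sums past the end of both sequences are constant, so finitely many
   comparisons suffice. *)
Definition dominates (nu mu : seq nat) : bool :=
  all (fun k => sumn (take k mu) <= sumn (take k nu))%N
      (iota 0 (maxn (size mu) (size nu)).+1).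

(** * Tableaux

    A tableau is the list of its rows, bottom row first (French notation).
    The ordinal [i : 'I_n] stands for the entry [i + 1]; it also indexes the
    variable ['X_i], i.e. x_{i+1}. *)

Section Tableaux.
Variable n : nat.
Implicit Type t : seq (seq 'I_n).

Definition shape t : seq nat := map size t.

Definition is_tableau t : bool :=
  is_partition (shape t) && perm_eq (flatten t) (enum 'I_n).

(* As row lengths weakly decrease, [zip r1 r2] pairs each entry of the upper
   row [r2] with the entry of [r1] just below it. *)
Definition is_standard t : bool :=
  [&& is_tableau t,
      all (sorted (fun i j : 'I_n => i < j)%N) t
    & sorted (fun r1 r2 : seq 'I_n =>
                all (fun p : 'I_n * 'I_n => p.1 < p.2)%N (zip r1 r2)) t].

Definition syt := {t : seq (seq 'I_n) | is_standard t}.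

Definition reading_word t : seq 'I_n := flatten (rev t).

Definition row_of t (i : 'I_n) : nat := find (fun r => i \in r) t.
Definition col_of t (i : 'I_n) : nat := index i (nth [::] t (row_of t i)).

Definition row_stab t : {set 'S_n} :=
  [set s : 'S_n | [forall i, row_of t (s i) == row_of t i]].
Definition col_stab t : {set 'S_n} :=
  [set s : 'S_n | [forall i, col_of t (s i) == col_of t i]].

End Tableaux.

(** * Cocharge and catabolizability type *)

(* [cc_label w k] is the label of the letter [k] of [w], letters being
   0, ..., size w - 1. *)
Fixpoint cc_label (w : seq nat) (k : nat) : nat :=
  if k is k'.+1 then (cc_label w k' + (index k w < index k' w)%N)%N else 0%N.

Definition cc_word (w : seq nat) : seq nat := [seq cc_label w k | k <- w].

Definition cc_tableau n (t : seq (seq 'I_n)) : seq (seq nat) :=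
  let w := map val (reading_word t) in [seq [seq cc_label w (val i) | i <- r] | r <- t].

(* If [nu] is a partition, then [incr_nth nu a] (which pads with zeros) is
   sorted exactly when nu + epsilon_{a+1} is a partition. The pair ([::], nu)
   is made a fixed point. *)
Definition cat_step (xn : seq nat * seq nat) : seq nat * seq nat :=
  let: (x, nu) := xn in
  if x is b :: x' then
    let y := belast b x' in
    let a := last b x' in
    if is_partition (incr_nth nu a) then (y, incr_nth nu a) else (a.+1 :: y, nu)
  else xn.

(* [size w ^ 2] steps suffice as soon as the iteration terminates: see
   [ctypeP]. *)
Definition ctype (w : seq nat) : option (seq nat) :=
  let: (x, nu) := iter (size w ^ 2) cat_step (cc_word w, [::]) in
  if x is [::] then Some nu else None.

Section CtypeTermination.

Let energy (nu : seq nat) : nat := (\sum_(i < size nu) i * nth 0 nu i)%N.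

Let energyE nu m : (size nu <= m)%N ->
  energy nu = (\sum_(i < m) i * nth 0 nu i)%N.
Proof.
move=> le_m; rewrite /energy (big_ord_widen m (fun i => i * nth 0 nu i)%N le_m).
rewrite big_mkcond; apply: eq_bigr => i _.
by case: ltnP => // h; rewrite nth_default ?muln0.
Qed.

Let energy_incr nu a : energy (incr_nth nu a) = (energy nu + a)%N.
Proof.
rewrite (@energyE (incr_nth nu a) (maxn (size nu) a.+1)); last first.
  by rewrite size_incr_nth; case: ifP => _; rewrite ?leq_maxl ?leq_maxr.
rewrite (@energyE nu (maxn (size nu) a.+1)) ?leq_maxl //.
have lt_a : (a < maxn (size nu) a.+1)%N by rewrite leq_maxr.
under eq_bigr => i _ do rewrite nth_incr_nth addnC mulnDr.
rewrite big_split /=; congr addn.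
rewrite (bigD1 (Ordinal lt_a)) //= eqxx muln1 big1 ?addn0 // => i.
by rewrite -val_eqE /= eq_sym => /negPf ->; rewrite muln0.
Qed.

Let energy_bound nu : is_partition nu -> (energy nu <= (sumn nu).-1 * sumn nu)%N.
Proof.
case/andP=> _ nz.
have le_size : (size nu <= sumn nu)%N.
  elim: nu nz => //= b nu IH; rewrite inE negb_or eq_sym -lt0n => /andP[b0 /IH].
  by rewrite -add1n => h; apply: leq_add.
rewrite {2}sumnE (big_nth 0%N) big_mkord big_distrr /=.
apply: leq_sum => i _; rewrite leq_mul2r; apply/orP; right.
by rewrite -ltnS (leq_trans (ltn_ord i)) // (leq_trans le_size) // leqSpred.
Qed.

Let sumn_incr nu a : sumn (incr_nth nu a) = (sumn nu).+1.
Proof.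
elim: nu a => [|b nu IH] [|a] //=; last by rewrite IH addnS.
by elim: a => //= a; rewrite /incr_nth /= => ->.
Qed.

Let step_count k x nu nu' : is_partition nu ->
  iter k cat_step (x, nu) = ([::], nu') ->
  exists j, [/\ iter j cat_step (x, nu) = ([::], nu'), is_partition nu',
    (j + sumn x + energy nu = size x + energy nu')%N
    & sumn nu' = (size x + sumn nu)%N].
Proof.
elim: k x nu => [|k IH] [|b x] nu pnu //.
- by case=> <-; exists 0%N; split.
- by rewrite iterSr => /(IH _ _ pnu).
rewrite iterSr.
have szE : size (belast b x) = size x by rewrite size_belast.
have sumE : sumn (b :: x) = (sumn (belast b x) + last b x)%N.
  by rewrite lastI sumn_rcons.
have stepE : cat_step (b :: x, nu) =
  if is_partition (incr_nth nu (last b x))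
  then (belast b x, incr_nth nu (last b x))
  else ((last b x).+1 :: belast b x, nu) by [].
rewrite stepE; case: ifP => [pa|np] /IH [] // j [jE p' cnt sm];
  exists j.+1; split => //.
- by rewrite iterSr stepE pa.
- by move: cnt; rewrite sumE energy_incr szE /=; lia.
- by rewrite sm szE sumn_incr /=; lia.
- by rewrite iterSr stepE np.
- by move: cnt; rewrite sumE /= szE; lia.
- by rewrite sm /= szE.
Qed.

Lemma ctypeP (w nu : seq nat) :
  (exists k, iter k cat_step (cc_word w, [::]) = ([::], nu)) <->
  ctype w = Some nu.
Proof.
rewrite /ctype; split=> [[k kE]|]; last first.
  case E: (iter _ _ _) => [[|//] nu'] [<-].
  by exists (size w ^ 2)%N.
have fixd m : iter m cat_step ([::], nu) = ([::], nu) by elim: m => //= m ->.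
have [j [jE p' cnt sm]] := @step_count k (cc_word w) [::] nu isT kE.
have le_j : (j <= size w ^ 2)%N.
  have := energy_bound p'; rewrite sm /= addn0.
  move: cnt; rewrite /cc_word size_map {1}/energy big_ord0 addn0.
  by case: (size w) => [|m] /=; nia.
by rewrite -(subnK le_j) iterD jE fixd.
Qed.

End CtypeTermination.

(** * Garsia-Procesi modules *)

Section GarsiaProcesi.
Variables (n : nat) (mu : seq nat).

(* e_d(A) *)
Definition esym (A : {set 'I_n}) (d : nat) : {mpoly rat[n]} :=
  \sum_(B : {set 'I_n} | (B \subset A) && (#|B| == d)) \prod_(i in B) 'X_i.

(* The inequality d > |A| - (mu'_n + ... + mu'_{n-|A|+1}), written without
   subtraction. *)
Definition gp_generator (p : {mpoly rat[n]}) : Prop :=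
  exists (A : {set 'I_n}) (d : nat),
    (#|A| < d + \sum_(n - #|A| <= j < n) conj_part mu j)%N /\ p = esym A d.

Definition gp_ideal : {pred {mpoly rat[n]}} :=
  fun p => `[< exists s : seq ({mpoly rat[n]} * {mpoly rat[n]}),
    (forall q, q \in s -> gp_generator q.2) /\ p = \sum_(q <- s) q.1 * q.2 >].

Lemma gp_idealMl (q p : {mpoly rat[n]}) : p \in gp_ideal -> q * p \in gp_ideal.
Proof.
move=> /asboolP[s [gen_s ->]]; apply/asboolP.
exists [seq (q * g.1, g.2) | g <- s]; split=> [_ /mapP[g /gen_s gen_g ->] //|].
by rewrite big_map mulr_sumr; apply: eq_bigr => g _; rewrite mulrA.
Qed.

Lemma gp_ideal_zmod_closed : zmod_closed gp_ideal.
Proof.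
split=> [|p q].
  by apply/asboolP; exists [::]; rewrite big_nil.
move=> pI /(gp_idealMl (-1)) /asboolP[t [gen_t tE]].
have /asboolP[s [gen_s sE]] := pI; apply/asboolP; exists (s ++ t); split.
  by move=> g; rewrite mem_cat => /orP[/gen_s|/gen_t].
by rewrite big_cat /= -sE -tE mulN1r.
Qed.

HB.instance Definition _ :=
  GRing.isZmodClosed.Build {mpoly rat[n]} gp_ideal gp_ideal_zmod_closed.

Lemma gp_idealZ a (p : {mpoly rat[n]}) : p \in gp_ideal -> a *: p \in gp_ideal.
Proof. by rewrite -mul_mpolyC; apply: gp_idealMl. Qed.

Lemma gp_ideal_msym (s : 'S_n) (p : {mpoly rat[n]}) :
  p \in gp_ideal -> msym s p \in gp_ideal.
Proof.
move=> /asboolP[t [gen_t ->]]; apply/asboolP.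
exists [seq (msym s g.1, msym s g.2) | g <- t]; split; last first.
  by rewrite big_map rmorph_sum; apply: eq_bigr => g _; rewrite /= rmorphM.
move=> _ /mapP[g /gen_t[A [d [lt_d ->]]] ->] /=.
exists (s @: A), d; split; first by rewrite card_imset //; apply: perm_inj.
rewrite rmorph_sum [RHS](reindex_inj (imset_inj (@perm_inj _ s))) /=.
apply: eq_big => [B|B _].
  rewrite card_imset; last exact: perm_inj.
  congr andb; apply/idP/idP => [|/subsetP sAB]; first exact: imsetS.
  apply/subsetP=> i iB; have := sAB (s i) (imset_f _ iB).
  by rewrite mem_imset //; apply: perm_inj.
rewrite rmorph_prod big_imset /=; last by move=> i j _ _; apply: perm_inj.
by apply: eq_bigr => i _; rewrite /msym mmapX mmap1U.
Qed.

End GarsiaProcesi.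

(* Only the structure of R_mu as a rational representation of 'S_n is needed,
   hence the quotient is built as a vector space, not as a ring. *)
Definition gp_module (n : nat) (mu : seq nat) : Type :=
  {ideal_quot (@gp_ideal n mu)}.

Section GarsiaProcesiModule.
Variables (n : nat) (mu : seq nat).
Local Notation R_mu := (gp_module n mu).

HB.instance Definition _ := GRing.Zmodule.on R_mu.

Definition gp_pi (p : {mpoly rat[n]}) : R_mu :=
  \pi_{ideal_quot (@gp_ideal n mu)} p.

Definition gp_repr (x : R_mu) : {mpoly rat[n]} :=
  repr (x : {ideal_quot (@gp_ideal n mu)}).

Lemma gp_reprK : cancel gp_repr gp_pi.
Proof. exact: reprK. Qed.

Lemma gp_pi_eq p q : gp_pi p = gp_pi q <-> p - q \in @gp_ideal n mu.
Proof. by rewrite Quotient.idealrBE; split=> /eqP. Qed.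

Lemma gp_piD : {morph gp_pi : p q / p + q}.
Proof. by move=> p q; rewrite /gp_pi raddfD. Qed.

Definition gp_scale (a : rat) (x : R_mu) : R_mu := gp_pi (a *: gp_repr x).

Lemma gp_piZ a p : gp_pi (a *: p) = gp_scale a (gp_pi p).
Proof.
by apply/gp_pi_eq; rewrite -scalerBr; apply/gp_idealZ/gp_pi_eq; rewrite gp_reprK.
Qed.

Fact gp_scaleA a b x : gp_scale a (gp_scale b x) = gp_scale (a * b) x.
Proof. by rewrite -[x]gp_reprK -!gp_piZ scalerA. Qed.

Fact gp_scale1 : left_id 1 gp_scale.
Proof. by move=> x; rewrite -[x]gp_reprK -!gp_piZ scale1r. Qed.

Fact gp_scaleDr : right_distributive gp_scale +%R.
Proof.
move=> a x y; rewrite -[x]gp_reprK -[y]gp_reprK.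
by rewrite -gp_piD -!gp_piZ -gp_piD scalerDr.
Qed.

Fact gp_scaleDl x : {morph gp_scale^~ x : a b / a + b}.
Proof.
by move=> a b; rewrite -[x]gp_reprK -!gp_piZ -gp_piD scalerDl.
Qed.

HB.instance Definition _ := GRing.Zmodule_isLmodule.Build rat R_mu
  gp_scaleA gp_scale1 gp_scaleDr gp_scaleDl.

Fact gp_pi_is_linear : linear gp_pi.
Proof. by move=> a p q; rewrite gp_piD gp_piZ. Qed.

HB.instance Definition _ :=
  GRing.isLinear.Build rat {mpoly rat[n]} R_mu _ gp_pi gp_pi_is_linear.

(* The action of 'S_n induced by x_i |-> x_{s i}. *)
Definition gp_act (s : 'S_n) (x : R_mu) : R_mu := gp_pi (msym s (gp_repr x)).

Lemma gp_act_pi s p : gp_act s (gp_pi p) = gp_pi (msym s p).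
Proof.
apply/gp_pi_eq; rewrite -raddfB.
by apply/gp_ideal_msym/gp_pi_eq; rewrite gp_reprK.
Qed.

End GarsiaProcesiModule.

(** * Higher Specht polynomials *)

Section HigherSpecht.
Variable n : nat.
Implicit Types S T : seq (seq 'I_n).

(* For S and T of the same shape, flattening pairs off their cells. *)
Definition tableau_monomial T (labels : seq (seq nat)) : {mpoly rat[n]} :=
  \prod_(u <- zip (flatten T) (flatten labels)) 'X_(u.1) ^+ u.2.

(* [msym tau (msym sigma p)] applies [sigma] first, as tau sigma does; the
   product of ['S_n] in the library composes in the other order. *)
Definition young_symmetrizer T (p : {mpoly rat[n]}) : {mpoly rat[n]} :=
  \sum_(tau in col_stab T) \sum_(sigma in row_stab T)
    (-1) ^+ odd_perm tau *: msym tau (msym sigma p).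

Definition higher_specht S T : {mpoly rat[n]} :=
  young_symmetrizer T (tableau_monomial T (cc_tableau S)).

Definition Sigma (mu : seq nat) : {pred syt n} := fun S : syt n =>
  if ctype (map val (reading_word (val S))) is Some nu
  then dominates nu mu else false.

End HigherSpecht.

(** * Specht modules

    M is the space of functions on all maps from entries to rows; a tabloid
    {T} is the map sending each entry to its row in T. *)

Section Specht.
Variable n : nat.

Definition tabloid := {ffun 'I_n -> 'I_n.+1}.
Definition tabloid_module := {ffun tabloid -> rat^o}.

Definition tabloid_of (t : seq (seq 'I_n)) : tabloid :=
  [ffun i => inord (row_of t i)].

Definition tabloid_vec (u : tabloid) : tabloid_module := [ffun v => (v == u)%:R].

(* s {T} = {s T}: the entry [s i] of s {T} is in the row of [i] in {T}. *)
Definition tabloid_act (s : 'S_n) (f : tabloid_module) : tabloid_module :=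
  [ffun u : tabloid => f [ffun i => u (s i)]].

Definition polytabloid (t : seq (seq 'I_n)) : tabloid_module :=
  \sum_(tau in col_stab t)
    (-1) ^+ odd_perm tau *: tabloid_act tau (tabloid_vec (tabloid_of t)).

End Specht.

(** * Bases and representations *)

Definition span (K : fieldType) (V : lmodType K) (G : V -> Prop) (v : V) : Prop :=
  exists s : seq (K * V),
    (forall p, p \in s -> G p.2) /\ v = \sum_(p <- s) p.1 *: p.2.

Definition is_basis (K : fieldType) (V : lmodType K) (I : eqType) (b : I -> V) :
    Prop :=
  (forall (s : seq I) (c : I -> K), uniq s ->
     \sum_(i <- s) c i *: b i = 0 -> forall i, i \in s -> c i = 0) /\
  (forall v, span (fun w => exists i, w = b i) v).

Definition specht_module n (rho : seq nat) : tabloid_module n -> Prop :=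
  span (fun v => exists t, [/\ is_tableau t, shape t = rho & v = polytabloid t]).

(* The subspaces U of V and U' of V' are stable under the group elements,
   and they are isomorphic as representations. *)
Definition isomorphic_reps (K : fieldType) (G : Type) (V V' : lmodType K)
    (act : G -> V -> V) (act' : G -> V' -> V')
    (U : V -> Prop) (U' : V' -> Prop) : Prop :=
  [/\ forall g u, U u -> U (act g u),
      forall g u, U' u -> U' (act' g u)
    & exists phi : V -> V',
      [/\ forall a u v, U u -> U v -> phi (a *: u + v) = a *: phi u + phi v,
          forall g u, U u -> phi (act g u) = act' g (phi u),
          forall u v, U u -> U v -> phi u = phi v -> u = v,
          forall u, U u -> U' (phi u)
        & forall w, U' w -> exists2 u, U u & phi u = w]].

(* [higher_specht_basis mu A]: the polynomials F_T^S, with S in A and T of the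
   same shape as S, form a higher Specht basis of R_mu. *)
Definition higher_specht_basis n (mu : seq nat) (A : {pred syt n}) : Prop :=
  let I := {ST : syt n * syt n |
             (ST.1 \in A) && (shape (val ST.1) == shape (val ST.2))} in
  is_basis (fun i : I =>
    gp_pi mu (higher_specht (val (val i).1) (val (val i).2))) /\
  forall S : syt n, S \in A ->
    isomorphic_reps (@gp_act n mu) (@tabloid_act n)
      (span (fun x => exists T : syt n, shape (val T) = shape (val S) /\
                        x = gp_pi mu (higher_specht (val S) (val T))))
      (@specht_module n (shape (val S))).

(* Main.v *)
(* Put k = mu2.  For a two-row mu, Sigma_mu consists of the tableaux S_d with
   top row n-d+1, ..., n, for d <= k.  Indeed a letter never decreases while the
   catabolism algorithm moves it, so a type with at most two rows forces all
   cocharge labels to be 0 or 1 and the last one to be 0.  For S = S_d and T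
   with top row B, the polynomial F_T^S is |R(T)| times
   P_T = sum over tau in C(T) of sgn(tau) x_{tau(B)}, where x_B is the product
   of the variables in B.

   For the pairing that makes the monomials orthonormal, P_T is orthogonal to
   every multiple of a generator e_d(A) of I_mu when d(T) <= k: some column of
   T avoids the other variables involved, and its transposition negates P_T and
   fixes the multiple.  By positivity, the span of the P_T meets I_mu in 0.
   The standard P_T are independent by their leading monomials x_B, and they
   span R_mu, since modulo I_mu every monomial is a combination of ballot
   monomials x_B (B the top row of a standard tableau) of the same degree, and
   there are as many of these as standard P_T.  Finally {T} |-> x_B maps the
   polytabloids onto the P_T, and it is injective modulo I_mu on the Specht
   module by the same positivity argument. *)
From HB Require Import structures.
From mathcomp Require Import all_boot all_order all_algebra perm fingroup.
From mathcomp Require Import zify boolp mpoly.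
Require Import Defs.

Set Implicit Arguments.
Unset Strict Implicit.
Unset Printing Implicit Defensive.

Import Order.TTheory GRing.Theory Num.Theory.

(** * Spans and squarefree monomials *)

Section Spans.
Local Open Scope ring_scope.

Variables (K : fieldType) (V : lmodType K).
Implicit Types (G H : V -> Prop) (u v : V).

Lemma mem_span G v : G v -> span G v.
Proof.
move=> Gv; exists [:: (1, v)]; split; last by rewrite big_seq1 scale1r.
by move=> p; rewrite inE => /eqP->.
Qed.

Lemma span0 G : span G 0.
Proof. by exists [::]; rewrite big_nil. Qed.

Lemma spanD G u v : span G u -> span G v -> span G (u + v).
Proof.
move=> [s [Gs ->]] [t [Gt ->]]; exists (s ++ t); rewrite big_cat; split=> // p.
by rewrite mem_cat => /orP[/Gs|/Gt].
Qed.

Lemma spanZ G a v : span G v -> span G (a *: v).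
Proof.
move=> [s [Gs ->]]; exists [seq (a * p.1, p.2) | p <- s]; split.
  by move=> _ /mapP[p /Gs Gp ->].
by rewrite big_map scaler_sumr; apply: eq_bigr => p _; rewrite scalerA.
Qed.

Lemma spanB G u v : span G u -> span G v -> span G (u - v).
Proof. by move=> Gu /(spanZ (-1)); rewrite scaleN1r; apply: spanD. Qed.

Lemma span_sum G I (r : seq I) (P : pred I) (F : I -> V) :
  (forall i, P i -> span G (F i)) -> span G (\sum_(i <- r | P i) F i).
Proof. by move=> GF; elim/big_ind: _ => //; [exact: span0|exact: spanD]. Qed.

Lemma sub_span G H : (forall v, G v -> span H v) -> forall v, span G v -> span H v.
Proof.
move=> GH v [s [Gs ->]]; rewrite big_seq; apply: span_sum => p /Gs /GH.
exact: spanZ.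
Qed.

Lemma span_family m (s : 'I_m -> V) v : span (fun w => exists i, w = s i) v ->
  exists c : 'I_m -> K, v = \sum_i c i *: s i.
Proof.
move=> [r [rs ->]]; elim: r rs => [|[a w] r IH] rs.
  by exists (fun=> 0); rewrite big_nil big1 // => i _; rewrite scale0r.
have [|c cE] := IH; first by move=> p pr; apply: rs; rewrite inE pr orbT.
have [i /= ->] := rs _ (mem_head _ _); exists (fun k => a *+ (k == i) + c k).
rewrite big_cons cE /=; under [RHS]eq_bigr => k _ do rewrite scalerDl.
rewrite [RHS]big_split /=; congr (_ + _).
by rewrite (bigD1 i) //= eqxx big1 ?addr0 // => k /negPf->; rewrite scale0r.
Qed.

(* The transition matrix is square and has trivial left kernel. *)
Lemma span_of_free m (b s : 'I_m -> V) :
    (forall i, span (fun w => exists j, w = s j) (b i)) ->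
    (forall c : 'I_m -> K, \sum_i c i *: b i = 0 -> forall i, c i = 0) ->
  forall j, span (fun v => exists i, v = b i) (s j).
Proof.
move=> /(fun sb i => span_family (sb i)) /fin_all_exists[c cE] b_free.
pose M : 'M[K]_m := \matrix_(i, j) c i j.
have bE i : b i = \sum_j M i j *: s j.
  by rewrite cE; apply: eq_bigr => j _; rewrite mxE.
have Munit : M \in unitmx.
  rewrite -row_free_unit -kermx_eq0; apply/rowV0P => v /sub_kermxP vM0.
  apply/rowP=> i; rewrite mxE; apply: (b_free (fun i => v ord0 i)).
  under eq_bigr => k _ do rewrite bE scaler_sumr.
  rewrite exchange_big /= big1 // => j _.
  under eq_bigr => k _ do rewrite scalerA.
  rewrite -scaler_suml; move/rowP/(_ j): vM0; rewrite [LHS]mxE [RHS]mxE => ->.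
  by rewrite scale0r.
move=> j; have -> : s j = \sum_i invmx M j i *: b i.
  under eq_bigr => i _ do rewrite bE scaler_sumr.
  rewrite exchange_big /= (bigD1 j) //= [X in _ + X]big1 => [|k kj].
    under eq_bigr => i _ do rewrite scalerA.
    rewrite -scaler_suml; have := mulVmx Munit => /matrixP/(_ j j).
    by rewrite [LHS]mxE [RHS]mxE eqxx => ->; rewrite scale1r addr0.
  under eq_bigr => i _ do rewrite scalerA.
  rewrite -scaler_suml; have := mulVmx Munit => /matrixP/(_ j k).
  by rewrite [LHS]mxE [RHS]mxE eq_sym (negPf kj) => ->; rewrite scale0r.
by apply: span_sum => i _; apply/spanZ/mem_span; exists i.
Qed.

End Spans.

Lemma span_linear (K : fieldType) (V W : lmodType K) (f : {linear V -> W})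
    (G : V -> Prop) (H : W -> Prop) :
  (forall v, G v -> span H (f v)) -> forall v, span G v -> span H (f v).
Proof.
move=> GH v [s [Gs ->]]; rewrite linear_sum big_seq; apply: span_sum => p /Gs /GH.
by rewrite linearZ; apply: spanZ.
Qed.

(** * Squarefree monomials, their pairing and a triangularity criterion *)

Section SquarefreeMonomials.
Local Open Scope ring_scope.
Variable n : nat.
Implicit Types (A B C : {set 'I_n}) (m : 'X_{1..n}) (p q : {mpoly rat[n]}).

Definition mset B : 'X_{1..n} := [multinom nat_of_bool (i \in B) | i < n].
Definition xset B : {mpoly rat[n]} := \prod_(i in B) 'X_i.

Lemma mset_inj : injective mset.
Proof.
move=> A B /mnmP E; apply/setP=> i; move: (E i); rewrite !mnmE.
by case: (i \in A); case: (i \in B).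
Qed.

Lemma xsetE B : xset B = 'X_[mset B].
Proof.
rewrite /xset mprodXE; congr 'X_[_]; apply/mnmP=> i.
rewrite mnm_sumE mnmE big_mkcond /= (bigD1 i) //= big1 => [|j ji].
  by case: (i \in B); rewrite ?mnm1E ?eqxx.
by case: (j \in B); rewrite // mnm1E (negPf ji).
Qed.

Lemma mcoeff_xset B C : (xset B)@_(mset C) = (B == C)%:R.
Proof. by rewrite xsetE mcoeffX (inj_eq mset_inj). Qed.

Lemma msym_xset (s : 'S_n) B : msym s (xset B) = xset (s @: B).
Proof.
rewrite /xset rmorph_prod big_imset /=; last by move=> i j _ _; apply: perm_inj.
by apply: eq_bigr => i _; rewrite /msym mmapX mmap1U.
Qed.

Lemma xsetD B C : [disjoint B & C] -> xset (B :|: C) = xset B * xset C.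
Proof.
move=> dBC; rewrite /xset -bigU //=; by apply: eq_bigl => i; rewrite !inE.
Qed.

Lemma esymE A d :
  esym A d = \sum_(B : {set 'I_n} | (B \subset A) && (#|B| == d)) xset B.
Proof. by []. Qed.

(** A squarefree product leaves no room for a repeated variable, so the cofactor of x_B is
    squarefree and avoids [B]. *)
Lemma mset_add m B C : (m + mset B)%MM = mset C -> B \subset C /\ m = mset (C :\: B).
Proof.
move=> /mnmP E.
have sBC : B \subset C.
  by apply/subsetP=> i iB; move: (E i); rewrite mnmDE !mnmE iB; case: (i \in C); lia.
split=> //; apply/mnmP=> i; move: (E i); rewrite mnmDE !mnmE in_setD.
by case: (i \in B); case: (i \in C) => /=; lia.
Qed.

(** Squarefree monomials are orthonormal for this pairing, and all other monomials lie in its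
    radical. *)
Definition dotp p q : rat := \sum_B p@_(mset B) * q@_(mset B).

Lemma dotp_sumr p I (r : seq I) (P : pred I) (F : I -> {mpoly rat[n]}) :
  dotp p (\sum_(i <- r | P i) F i) = \sum_(i <- r | P i) dotp p (F i).
Proof.
rewrite /dotp exchange_big /=; apply: eq_bigr => B _.
by rewrite raddf_sum mulr_sumr.
Qed.

Lemma dotpZr p a q : dotp p (a *: q) = a * dotp p q.
Proof.
by rewrite /dotp mulr_sumr; apply: eq_bigr => B _; rewrite mcoeffZ mulrCA.
Qed.

Lemma dotpC p q : dotp p q = dotp q p.
Proof. by apply: eq_bigr => B _; rewrite mulrC. Qed.

Lemma dotp_sym (s : 'S_n) p q : dotp (msym s p) (msym s q) = dotp p q.
Proof.
rewrite /dotp [RHS](reindex_inj (imset_inj (@perm_inj _ s^-1%g))) /=.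
apply: eq_bigr => B _; rewrite !mcoeff_sym.
suff -> : [multinom mset B (s i) | i < n] = mset (s^-1%g @: B) by [].
apply/mnmP=> i; rewrite !mnmE; congr nat_of_bool.
by rewrite -{2}(permK s i) mem_imset //; apply: perm_inj.
Qed.

(** Not squarefreeness in the sense of factorization: [p] is a linear combination of squarefree
    monomials. *)
Definition squarefree p := p = \sum_B p@_(mset B) *: xset B.

(** A sum of rational squares vanishes only if every term does, and the coefficients seen by [dotp]
    determine a squarefree [p]. *)
Lemma dotp_eq0 p : squarefree p -> dotp p p = 0 -> p = 0.
Proof.
move=> pE /eqP; rewrite psumr_eq0; last by move=> B _; rewrite -expr2 sqr_ge0.
move=> /allP p0; rewrite pE big1 // => B _.
have := p0 B (mem_index_enum B); rewrite mulf_eq0 orbb => /eqP->.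
by rewrite scale0r.
Qed.

Lemma squarefree_xset B : squarefree (xset B).
Proof.
rewrite /squarefree (bigD1 B) //= mcoeff_xset eqxx scale1r big1 ?addr0 // => C.
by rewrite mcoeff_xset eq_sym => /negPf->; rewrite scale0r.
Qed.

Lemma squarefree_span p : span (fun v => exists B, v = xset B) p -> squarefree p.
Proof.
move=> [s [sX ->]]; rewrite /squarefree.
under [RHS]eq_bigr => B _ do rewrite raddf_sum scaler_suml.
rewrite [RHS]exchange_big /= big_seq [RHS]big_seq; apply: eq_bigr => c /sX[B cB].
under eq_bigr => C _ do rewrite /= mcoeffZ -scalerA.
by rewrite -scaler_sumr cB -squarefree_xset.
Qed.

(** Among the indices with nonzero coefficient, take one whose leading set has maximal weight: no
    other term of the sum contributes to its leading monomial. *)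
Lemma triangular_free (I : eqType) (P : I -> {mpoly rat[n]}) (B : I -> {set 'I_n})
    (wt : {set 'I_n} -> nat) (s : seq I) (c : I -> rat) :
    uniq s -> {in s &, injective B} ->
    (forall i, i \in s -> (P i)@_(mset (B i)) != 0) ->
    (forall i C, i \in s -> (P i)@_(mset C) != 0 ->
      C = B i \/ (wt C < wt (B i))%N) ->
  \sum_(i <- s) c i *: P i = 0 -> forall i, i \in s -> c i = 0.
Proof.
move=> s_uniq B_inj P_lead P_low sum0 i0 i0s; apply/eqP/negPn/negP => ci0.
pose bad k := has (fun i => (c i != 0) && (wt (B i) == k)) s.
have exb : exists k, bad k.
  by exists (wt (B i0)); apply/hasP; exists i0; rewrite ?ci0 ?eqxx.
have ubb k : bad k -> (k <= \sum_(i <- s) wt (B i))%N.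
  move=> /hasP[i si /andP[_ /eqP<-]].
  by rewrite (big_rem i) //= leq_addr.
case: (ex_maxnP exb ubb) => k /hasP[i si /andP[ci /eqP wk]] kmax.
have := congr1 (mcoeff (mset (B i))) sum0.
rewrite mcoeff0 raddf_sum (big_rem i) //= big_seq big1 => [|j].
  by rewrite addr0 mcoeffZ => /eqP; rewrite mulf_eq0 (negPf ci) (negPf (P_lead i si)).
rewrite mem_rem_uniq // inE => /andP[ji sj]; rewrite mcoeffZ.
apply/eqP; rewrite mulf_eq0; apply/norP => -[cj].
move=> /(P_low j _ sj)[/B_inj E|lt_w]; first by rewrite E ?eqxx in ji.
have := kmax (wt (B j)); rewrite leqNgt -wk lt_w => /(_ _)/negP[] //.
by apply/hasP; exists j; rewrite ?cj ?eqxx.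
Qed.

End SquarefreeMonomials.

(** * Two-row tableaux and their Specht polynomials *)

Section TwoRowTableaux.
Variable n : nat.
Implicit Types (t : seq (seq 'I_n)) (B C : {set 'I_n}).

Definition bottom_row t := nth [::] t 0.
Definition top_row t := nth [::] t 1.
Definition tops t : {set 'I_n} := [set i in top_row t].

(** At most two rows: a tableau with a single row, or with none, is included and has [tops t]
    empty. *)
Definition two_rowed t := is_tableau t && (size t <= 2).

(** Empty rows are dropped because a shape has no zero parts. *)
Definition stack (r0 r1 : seq 'I_n) := [seq r <- [:: r0; r1] | ~~ nilp r].

Lemma stackE t : two_rowed t -> t = stack (bottom_row t) (top_row t).
Proof.
move=> /andP[/andP[/andP[_ nz] _] sz]; move: nz sz.
case: t => [|[|a r0] [|[|b r1] [|]]] //=; rewrite !inE //= ?eqxx //.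
Qed.

Lemma flatten_rows t : two_rowed t -> flatten t = bottom_row t ++ top_row t.
Proof. by case: t => [|r0 [|r1 [|r2 t]]] /andP[] //=; rewrite !cats0. Qed.

Lemma uniq_rows t : two_rowed t -> uniq (bottom_row t ++ top_row t).
Proof.
move=> t2; rewrite -flatten_rows //; case/andP: t2 => /andP[_ /perm_uniq-> _].
exact: enum_uniq.
Qed.

Lemma mem_bottom t i : two_rowed t -> (i \in bottom_row t) = (i \notin tops t).
Proof.
move=> t2; have := uniq_rows t2; rewrite cat_uniq inE => /and3P[_ /hasPn disj _].
have : i \in bottom_row t ++ top_row t.
  rewrite -flatten_rows //; case/andP: t2 => /andP[_ /perm_mem-> _].
  by rewrite mem_enum.
rewrite mem_cat; case: (boolP (i \in top_row t)) => [/disj/negPf->//|_].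
by rewrite orbF => ->.
Qed.

Lemma row_ofE t i : two_rowed t -> row_of t i = (i \in tops t).
Proof.
move=> t2; have := mem_bottom i t2; rewrite /row_of /bottom_row /tops /top_row inE.
case/andP: t2 => _; case: t => [|r0 [|r1 [|r2 t]]] //= _; rewrite ?in_nil /=.
- by move=> ->.
- by case: (i \in r1) => ->.
Qed.

Lemma col_ofE t i : two_rowed t ->
  col_of t i = index i (if i \in tops t then top_row t else bottom_row t).
Proof. by move=> t2; rewrite /col_of row_ofE //; case: ifP. Qed.

Lemma size_rows t : two_rowed t -> size (top_row t) <= size (bottom_row t).
Proof.
move=> /andP[/andP[/andP[srt _] _] sz]; move: srt sz.
by case: t => [|r0 [|r1 [|r2 t]]] //= /andP[].
Qed.

Lemma card_tops t : two_rowed t -> #|tops t| = size (top_row t).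
Proof.
move=> /uniq_rows; rewrite cat_uniq => /and3P[_ _ u].
by rewrite /tops cardsE; apply/card_uniqP.
Qed.

Lemma nth_shape t i : nth 0 (shape t) i = size (nth [::] t i).
Proof. by elim: t i => [|r t IH] [|i] //=. Qed.

Lemma size_bottom t : two_rowed t -> size (bottom_row t) = n - #|tops t|.
Proof.
move=> t2; have := congr1 size (flatten_rows t2); rewrite size_cat -card_tops //.
case/andP: (t2) => /andP[_ /perm_size->] _; rewrite size_enum_ord; lia.
Qed.

Lemma shapeE t : two_rowed t ->
  shape t = [seq m <- [:: n - #|tops t|; #|tops t|] | 0 < m].
Proof.
move=> t2; rewrite {1}(stackE t2) -size_bottom // card_tops //.
by rewrite /stack /=; case: (bottom_row t) => [|? ?]; case: (top_row t).
Qed.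

Lemma eq_shape t t' : two_rowed t -> two_rowed t' ->
  (shape t == shape t') = (#|tops t| == #|tops t'|).
Proof.
move=> t2 t2'; apply/eqP/eqP=> E; last by rewrite !shapeE // E.
by rewrite !card_tops // /top_row -!nth_shape E.
Qed.

(** The entry just below [b] when [b] is in the top row; the default of [nth] is then never reached,
    since the bottom row is at least as long. *)
Definition partner t (b : 'I_n) := nth b (bottom_row t) (index b (top_row t)).

Lemma mem_partner t b : two_rowed t -> b \in tops t -> partner t b \in bottom_row t.
Proof.
move=> t2; rewrite inE => bt.
by rewrite mem_nth // (leq_trans _ (size_rows t2)) // index_mem.
Qed.

Lemma col_partner t b : two_rowed t -> b \in tops t ->
  col_of t (partner t b) = col_of t b.
Proof.
move=> t2 bt; rewrite !col_ofE // bt.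
have := mem_partner t2 bt; rewrite mem_bottom // => /negPf->.
have := uniq_rows t2; rewrite cat_uniq => /and3P[u _ _].
rewrite index_uniq //; rewrite inE in bt.
by rewrite (leq_trans _ (size_rows t2)) // index_mem.
Qed.

Lemma col_of_inj t i j : two_rowed t -> (i \in tops t) = (j \in tops t) ->
  col_of t i = col_of t j -> i = j.
Proof.
move=> t2 ij; rewrite !col_ofE // -ij; have := mem_bottom j t2.
have := mem_bottom i t2; rewrite -ij.
case: (boolP (i \in tops t)) ij => [it /ssrfun.esym jt _ _|_ _ ib jb]; last first.
  by move/index_inj; apply.
by rewrite !inE in it jt; move/index_inj; apply.
Qed.

(** There are [#|tops t|] disjoint columns of height two. If each met [Z], choosing an element of
    [Z] in each would inject [tops t] into [Z]. *)
Lemma column_avoiding t (Z : {set 'I_n}) : two_rowed t -> #|Z| < #|tops t| ->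
  exists a b, [/\ a \notin Z, b \notin Z, a != b & col_of t a = col_of t b].
Proof.
move=> t2 ltZ; case: (pickP [pred b in tops t | (b \notin Z) && (partner t b \notin Z)]).
  move=> b /and3P[bt bZ aZ]; exists (partner t b), b; rewrite col_partner //; split=> //.
  by apply: contraTneq (mem_partner t2 bt) => ->; rewrite mem_bottom // bt.
move=> none; pose f b := if b \in Z then b else partner t b.
suff : #|f @: tops t| <= #|Z|.
  rewrite card_in_imset; first by rewrite leqNgt ltZ.
  move=> b b' bt bt' E.
  apply: (col_of_inj t2); first by rewrite bt bt'.
  have colf c : c \in tops t -> col_of t (f c) = col_of t c.
    by move=> ct; rewrite /f; case: ifP => // _; apply: col_partner.
  by rewrite -colf // E colf.
apply/subset_leq_card/subsetP=> _ /imsetP[b bt ->]; rewrite /f.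
case: ifP => // bZ; have := none b; rewrite inE /= bt bZ /=.
by case: (_ \in Z).
Qed.

End TwoRowTableaux.

(** * Specht polynomials and their orthogonality to multiples of e_d(A) *)

Section SpechtPolynomials.
Local Open Scope ring_scope.
Variable n : nat.
Implicit Types (t : seq (seq 'I_n)) (A B C : {set 'I_n}).

(* Up to a nonzero factor, F_T^S when the labels of S are 0 on the bottom row
   and 1 on the top row. *)
Definition specht_poly t : {mpoly rat[n]} :=
  \sum_(tau in col_stab t) (-1) ^+ odd_perm tau *: xset (tau @: tops t).

Lemma mcoeff_specht t B : (specht_poly t)@_(mset B) != 0 ->
  exists2 tau, tau \in col_stab t & tau @: tops t = B.
Proof.
rewrite raddf_sum; apply: contraNP => none; rewrite big1 // => tau tau_t.
rewrite /= mcoeffZ mcoeff_xset; case: eqP => [E|_]; last by rewrite mulr0.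
by case: none; exists tau.
Qed.

Lemma card_mcoeff_specht t B : (specht_poly t)@_(mset B) != 0 -> #|B| = #|tops t|.
Proof.
by move=> /mcoeff_specht[tau _ <-]; rewrite card_imset //; apply: perm_inj.
Qed.

(** Following a column permutation by the transposition of two entries of one column permutes the
    column stabilizer and flips all signs. *)
Lemma specht_poly_antisym t (a b : 'I_n) : a != b -> col_of t a = col_of t b ->
  msym (tperm a b) (specht_poly t) = - specht_poly t.
Proof.
move=> ab cab; rewrite raddf_sum -sumrN.
rewrite [RHS](reindex_inj (mulIg (tperm a b))) /=; apply: eq_big => tau.
  rewrite !inE; apply: eq_forallb => i; rewrite permM.
  by case: tpermP => [->|->|//]; rewrite ?cab.
move=> _; rewrite /= msymZ msym_xset odd_permM odd_tperm ab.
rewrite -scaleNr; congr (_ *: xset _); first by case: (odd_perm tau); rewrite ?expr0 ?opprK.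
by rewrite -imset_comp; apply: eq_imset => i /=; rewrite permM.
Qed.

Lemma msym_esym (s : 'S_n) A d : msym s (esym A d) = esym (s @: A) d.
Proof.
rewrite !esymE raddf_sum [RHS](reindex_inj (imset_inj (@perm_inj _ s))) /=.
apply: eq_big => [B|B _]; last exact: msym_xset.
rewrite card_imset; last exact: perm_inj.
congr andb; apply/idP/idP => [|/subsetP sAB]; first exact: imsetS.
apply/subsetP=> i iB; have := sAB (s i) (imset_f _ iB).
by rewrite mem_imset //; apply: perm_inj.
Qed.

Lemma tperm_imset_id (a b : 'I_n) A : (a \in A) = (b \in A) -> tperm a b @: A = A.
Proof.
move=> ab; apply/setP=> i; rewrite -{1}(tpermK a b i) mem_imset; last exact: perm_inj.
by case: tpermP => [->|->|].
Qed.

Lemma mcoeffX_esym m A d B : ('X_[m] * esym A d)@_(mset B) != 0 ->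
  exists2 D : {set 'I_n}, (D \subset A) && (#|D| == d) & (m + mset D)%MM = mset B.
Proof.
rewrite esymE mulr_sumr raddf_sum; apply: contraNP => none.
rewrite big1 // => D DA; rewrite /= xsetE -mpolyXD mcoeffX.
by case: eqP => // E; case: none; exists D.
Qed.

(* If fewer than [#|tops t|] columns meet [C] and the complement of [A], the
   transposition of another column fixes x_C e_d(A) and negates the Specht
   polynomial. *)
Lemma dotp_specht_esym t (q : {mpoly rat[n]}) A d : two_rowed t ->
    [|| #|~: A| < d, #|tops t| < d | #|A| < d]%N ->
  dotp (specht_poly t) (q * esym A d) = 0.
Proof.
move=> t2 dlarge; rewrite (mpolyE q) mulr_suml dotp_sumr big1 // => m _.
rewrite -scalerAl dotpZr; apply/eqP; rewrite mulf_eq0; apply/orP; right.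
apply/negPn/negP => nz.
have [B [nzB1 /mcoeffX_esym[D /andP[DA /eqP Dd] mD]]] :
    exists B, (specht_poly t)@_(mset B) != 0 /\ ('X_[m] * esym A d)@_(mset B) != 0.
  move: nz; apply: contraNP => none; rewrite /dotp big1 // => B _.
  apply/eqP; rewrite mulf_eq0; apply/norP => -[? ?]; apply: none.
  by exists B.
have [DB mE] := mset_add mD.
have cBD : (#|B :\: D| + d = #|tops t|)%N.
  by rewrite cardsD (setIidPr DB) Dd -(card_mcoeff_specht nzB1) subnK // -Dd subset_leq_card.
(* [D] is a [d]-subset of both [A] and [B], so only the first alternative survives. Hence [B :\: D]
   and [~: A] together have fewer than [#|tops t|] elements. *)
have lt_Ad : (#|~: A| < d)%N.
  by move: dlarge (subset_leq_card DA); rewrite Dd; lia.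
have [||a [b [aZ bZ ab cab]]] := @column_avoiding _ t (B :\: D :|: ~: A) => //.
  by have := leq_card_setU (B :\: D) (~: A); case=> + _; lia.
move: aZ bZ; rewrite !inE !negb_or !negbK => /andP[aC aA] /andP[bC bA].
move: nz; apply/negP; rewrite negbK mE -xsetE.
set q' := (_ * _); have q'E : msym (tperm a b) q' = q'.
  rewrite /q' rmorphM /= msym_xset msym_esym !tperm_imset_id ?aA ?bA //.
  by rewrite !inE (negPf aC) (negPf bC).
(* The pairing is invariant under the transposition, so its value equals its own negative. *)
have := dotp_sym (tperm a b) (specht_poly t) q'.
rewrite specht_poly_antisym // q'E -scaleN1r dotpC dotpZr dotpC.
by move/eqP; rewrite mulN1r -subr_eq0 -opprD oppr_eq0 -mulr2n mulrn_eq0.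
Qed.

End SpechtPolynomials.

(** * Orthogonality to the ideal and leading monomials *)

Section TwoRowIdeal.
Local Open Scope ring_scope.
Variables (n mu1 mu2 : nat).
Hypotheses (le_mu : (mu2 <= mu1)%N) (mu_n : (mu1 + mu2 = n)%N).
Local Notation mu := [:: mu1; mu2].
Local Notation I_mu := (@gp_ideal n mu).
Implicit Types (t : seq (seq 'I_n)) (A B C : {set 'I_n}).

(** A row of length m counts once in each column j < m, and m is at most n; hence it contributes m -
    z, truncated at 0. *)
Lemma sum_conj_part z :
  (\sum_(z <= j < n) conj_part mu j = (mu1 - z) + (mu2 - z))%N.
Proof.
have sum_lt m N : (\sum_(z <= j < N) (j < m) = minn m N - z)%N.
  elim: N => [|N IH]; first by rewrite big_geq //; lia.
  case: (leqP z N) => [le_z|lt_z]; last by rewrite big_geq //; lia.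
  by rewrite big_nat_recr //= IH; case: (ltnP N m); lia.
have conjE j : conj_part mu j = ((j < mu1) + (j < mu2))%N.
  by rewrite /conj_part /= addn0.
under eq_bigr => j _ do rewrite conjE.
by rewrite big_split /= !sum_lt //; lia.
Qed.

Lemma gp_generator_esym A d :
  (#|A| < d + ((mu1 - (n - #|A|)) + (mu2 - (n - #|A|))))%N -> esym A d \in I_mu.
Proof.
move=> lt_d; apply/asboolP; exists [:: (1, esym A d)].
rewrite big_seq1 mul1r; split=> // _ /[!inE] /eqP->; exists A, d.
by rewrite sum_conj_part.
Qed.

(** Put z = [#|~: A|]. The condition on a generator e_d(A) reads z < d if z <= [mu2], [mu2] < d if
    [mu2] < z <= [mu1], and [#|A|] < d if z > [mu1]. These are the three alternatives of
    [dotp_specht_esym]. *)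
Lemma dotp_specht_ideal t p : two_rowed t -> (#|tops t| <= mu2)%N ->
  p \in I_mu -> dotp (specht_poly t) p = 0.
Proof.
move=> t2 le_t /asboolP[s [gen_s ->]]; rewrite big_seq dotp_sumr big1 // => q.
move=> /gen_s[A [d [+ ->]]]; rewrite sum_conj_part => lt_d.
apply: dotp_specht_esym => //; have := cardsC A; rewrite card_ord.
have := max_card A; rewrite card_ord; lia.
Qed.

Definition is_specht_poly (p : {mpoly rat[n]}) :=
  exists t, [/\ two_rowed t, (#|tops t| <= mu2)%N & p = specht_poly t].

Lemma specht_span_squarefree p : span is_specht_poly p -> squarefree p.
Proof.
move=> spp; apply: squarefree_span; move: p spp; apply: sub_span => p [t [_ _ ->]].
by apply: span_sum => tau _; apply/spanZ/mem_span; exists (tau @: tops t).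
Qed.

(** Such a [p] lies in the ideal and is orthogonal to it, hence is orthogonal to itself. *)
Lemma specht_ideal0 p : span is_specht_poly p -> p \in I_mu -> p = 0.
Proof.
move=> spp pI; apply: dotp_eq0; first exact: specht_span_squarefree.
case: spp => s [gen_s {1}->]; rewrite dotpC dotp_sumr big_seq big1 // => q.
move=> /gen_s[t [t2 le_t ->]]; rewrite dotpZr dotpC dotp_specht_ideal ?mulr0 //.
Qed.

End TwoRowIdeal.

(** * Standard tableaux and leading monomials *)

Section StandardTableaux.
Variable n : nat.
Implicit Types (t : seq (seq 'I_n)) (B C : {set 'I_n}).

(** The order behind both triangularity arguments: x_B with B = [tops t] is the heaviest monomial of
    the Specht polynomial of a standard [t], and straightening raises the weight. *)
Definition weight B : nat := \sum_(i in B) val i.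

Lemma weight_bound B : weight B <= n * n.
Proof.
apply: (@leq_trans (#|B| * n)).
  by rewrite /weight -sum_nat_const; apply: leq_sum => i _; rewrite ltnW // ltn_ord.
by rewrite leq_mul2r; have := max_card B; rewrite card_ord => ->; rewrite orbT.
Qed.

Definition ord_lt : rel 'I_n := fun i j => i < j.

Lemma ord_lt_trans : transitive ord_lt.
Proof. by move=> j i k; apply: ltn_trans. Qed.

Lemma sorted_enum_set B : sorted ord_lt (enum B).
Proof.
rewrite {1}/enum_mem; apply: sorted_filter; first exact: ord_lt_trans.
by rewrite -enumT; have := iota_ltn_sorted 0 n; rewrite -val_enum_ord sorted_map.
Qed.

Lemma standard_row_sorted t i : is_standard t -> sorted ord_lt (nth [::] t i).
Proof.
move=> /and3P[_ /allP rows _]; case: (ltnP i (size t)) => [lt_i|ge_i].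
  by apply: rows; rewrite mem_nth.
by rewrite nth_default.
Qed.

Lemma standard_below t i b : is_standard t -> b \in nth [::] t i.+1 ->
  let a := nth b (nth [::] t i) (index b (nth [::] t i.+1)) in
  a \in nth [::] t i /\ a < b.
Proof.
move=> /and3P[/andP[/andP[/(sortedP 0) part _] _] _ /(sortedP [::]) cols] bt.
have lt_i : i.+1 < size t by case: ltnP bt => // le_t; rewrite nth_default.
have := part i; rewrite size_map => /(_ lt_i); rewrite !nth_shape => le_rows.
have lt_b := bt; rewrite -index_mem in lt_b.
have lt_b' := leq_trans lt_b le_rows; split; first exact: mem_nth.
have /allP zipP := cols i lt_i.
have := zipP (nth (b, b) (zip (nth [::] t i) (nth [::] t i.+1)) (index b (nth [::] t i.+1))).
have lt_z : index b (nth [::] t i.+1) < size (zip (nth [::] t i) (nth [::] t i.+1)).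
  by rewrite size_zip leq_min lt_b lt_b'.
by rewrite mem_nth // nth_zip_cond lt_z /= nth_index //; apply.
Qed.

Lemma standard_partner t b : is_standard t -> b \in tops t -> partner t b < b.
Proof. by move=> st; rewrite inE => /(standard_below st)[]. Qed.

Lemma weight_imset (s : 'S_n) B : weight (s @: B) = \sum_(i in B) val (s i).
Proof. by rewrite /weight big_imset //= => i j _ _; apply: perm_inj. Qed.

(** A column permutation sends an entry of the top row to itself or to its partner, which is smaller
    by standardness. *)
Lemma weight_col_stab t tau : two_rowed t -> is_standard t -> tau \in col_stab t ->
  tau != 1%g -> weight (tau @: tops t) < weight (tops t).
Proof.
move=> t2 st; rewrite inE => /forallP tau_t tau1.
have colE i : col_of t (tau i) = col_of t i by apply/eqP.
have le_tau b : b \in tops t -> (tau b == b) || (tau b < b).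
  move=> bt; case: (boolP (tau b \in tops t)) => tbt.
    by rewrite (col_of_inj t2 _ (colE b)) ?eqxx // bt tbt.
  have -> : tau b = partner t b.
    apply: (col_of_inj t2); last by rewrite colE col_partner.
    by have := mem_partner t2 bt; rewrite mem_bottom // => /negPf->; rewrite (negPf tbt).
  by rewrite (standard_partner st bt) ?orbT.
rewrite weight_imset.
(* If [tau] fixed the top row pointwise, then by injectivity no bottom entry could move up, so [tau]
   would be the identity. *)
have [b bt tb] : exists2 b, b \in tops t & tau b != b.
  apply/exists_inP; apply: contraNT tau1 => /exists_inPn none.
  have fixt b : b \in tops t -> tau b = b by move/none/negPn/eqP.
  apply/eqP/permP=> i; rewrite perm1; case: (boolP (i \in tops t)) => [/fixt//|it].
  apply: (col_of_inj t2 _ (colE i)); rewrite (negPf it).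
  apply: contraNF it => tit; have := fixt _ tit => /perm_inj E.
  by rewrite -E.
rewrite /weight (bigD1 b) //= [X in _ < X](bigD1 b) //= -addSn leq_add //.
  by have := le_tau b bt; rewrite (negPf tb).
apply: leq_sum => c /andP[ct _]; have := le_tau c ct.
by case/orP => [/eqP->//|/ltnW].
Qed.

Local Open Scope ring_scope.

Lemma mcoeff_specht_top t : two_rowed t -> is_standard t ->
  (specht_poly t)@_(mset (tops t)) = 1.
Proof.
move=> t2 st; have one_t : 1%g \in col_stab t.
  by rewrite inE; apply/forallP=> i; rewrite perm1.
rewrite raddf_sum (bigD1 1%g) //= odd_perm1 expr0 scale1r mcoeff_xset.
have -> : (1%g : 'S_n) @: tops t = tops t.
  by rewrite -[RHS]imset_id; apply: eq_imset => i; rewrite perm1.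
rewrite eqxx big1 ?addr0 // => tau /andP[tau_t tau1].
rewrite mcoeffZ mcoeff_xset; case: eqP => [E|_]; last by rewrite mulr0.
by have := weight_col_stab t2 st tau_t tau1; rewrite E ltnn.
Qed.

Lemma mcoeff_specht_low t C : two_rowed t -> is_standard t ->
  (specht_poly t)@_(mset C) != 0 -> C = tops t \/ (weight C < weight (tops t))%N.
Proof.
move=> t2 st /mcoeff_specht[tau tau_t <-].
have [->|tau1] := eqVneq tau 1%g; last by right; apply: weight_col_stab.
by left; rewrite -[RHS]imset_id; apply: eq_imset => i; rewrite perm1.
Qed.

(** Rows are increasing, hence determined by their sets of entries, and the bottom row is the
    complement of the top one. *)
Lemma standard_tops_inj t t' : two_rowed t -> is_standard t ->
  two_rowed t' -> is_standard t' -> tops t = tops t' -> t = t'.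
Proof.
move=> t2 st t2' st' E.
have row_eq i : nth [::] t i =i nth [::] t' i -> nth [::] t i = nth [::] t' i.
  apply: irr_sorted_eq; try exact: standard_row_sorted.
    exact: ord_lt_trans.
  by move=> x; rewrite /ord_lt ltnn.
have topE : top_row t = top_row t'.
  by apply: row_eq => i; have /setP/(_ i) := E; rewrite !inE.
have botE : bottom_row t = bottom_row t'.
  by apply: row_eq => i; rewrite -!/(bottom_row _) !mem_bottom // E.
by rewrite (stackE t2) (stackE t2') topE botE.
Qed.

Lemma specht_free (I : eqType) (T : I -> seq (seq 'I_n)) (s : seq I) (c : I -> rat) :
    uniq s -> {in s &, injective T} ->
    (forall i, i \in s -> two_rowed (T i) /\ is_standard (T i)) ->
  \sum_(i <- s) c i *: specht_poly (T i) = 0 -> forall i, i \in s -> c i = 0.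
Proof.
move=> us Tinj sT; apply: (triangular_free (B := fun i => tops (T i)) (wt := weight)) => //.
- move=> i j si sj E; apply: Tinj => //.
  by apply: standard_tops_inj; have := sT i si; have := sT j sj; case=> ? ? [? ?].
- by move=> i /sT[? ?]; rewrite mcoeff_specht_top // oner_eq0.
- by move=> i C /sT[? ?]; apply: mcoeff_specht_low.
Qed.

End StandardTableaux.

(** * Ballot sets and straightening *)

Section BallotSets.
Variable n : nat.
Implicit Types (B C : {set 'I_n}) (s : seq 'I_n).

(* The sets of entries of the top rows of the standard tableaux with at most
   two rows. *)
Definition ballot B := [forall b in B,
  #|[set c in B | c <= b]| <= #|[set a in ~: B | a < b]|].

Definition tab_of B := stack (enum (~: B)) (enum B).

Lemma card_set_count B (p : pred 'I_n) : #|[set c in B | p c]| = count p (enum B).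
Proof.
have u : uniq (filter p (enum B)) by rewrite filter_uniq ?enum_uniq.
rewrite -size_filter -(card_uniqP u); apply: eq_card => i.
by rewrite !inE mem_filter mem_enum andbC.
Qed.

Lemma sorted_nth_lt s (x x0 : 'I_n) j : sorted (@ord_lt n) s ->
  j < count (fun y : 'I_n => y < x) s -> nth x0 s j < x.
Proof.
elim: s j => //= y s IH j ys; have lt_y := order_path_min (@ord_lt_trans n) ys.
case: (ltnP y x) => [yx|xy].
  by case: j => //= j; rewrite add1n => /IH; apply; apply: path_sorted ys.
rewrite add0n => lt_j; have: has (fun z : 'I_n => z < x) s.
  by rewrite has_count (leq_ltn_trans _ lt_j).
by move=> /hasP[z /(allP lt_y) yz]; rewrite ltnNge (leq_trans xy (ltnW yz)).
Qed.

Lemma sorted_count_le s (x0 : 'I_n) j : sorted (@ord_lt n) s -> j < size s ->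
  j < count (fun y : 'I_n => y <= nth x0 s j) s.
Proof.
elim: s j => //= y s IH [|j] ys; first by rewrite leqnn.
rewrite ltnS => lt_j.
have /allP/(_ _ (mem_nth x0 lt_j)) := order_path_min (@ord_lt_trans n) ys.
move=> /ltnW->; rewrite add1n ltnS; apply: IH => //; exact: path_sorted ys.
Qed.

(** Positions count from 0: up to its element at position [j], the set [B] has at least [j.+1]
    elements, so the ballot condition puts at least [j.+1] elements of the complement below it. This
    is the column condition of [tab_of B]. *)
Lemma ballot_nth B x0 j : ballot B -> j < #|B| ->
  j < #|~: B| /\ nth x0 (enum (~: B)) j < nth x0 (enum B) j.
Proof.
move=> /forall_inP bB; rewrite {1}cardE => lt_j; set b := nth x0 (enum B) j.
have bB' : b \in B by rewrite -mem_enum mem_nth.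
have := leq_trans _ (bB b bB') => /(_ j.+1).
rewrite !card_set_count => /(_ (sorted_count_le x0 (sorted_enum_set B) lt_j)) lt_c.
split; last exact: sorted_nth_lt (sorted_enum_set _) lt_c.
by rewrite cardE (leq_trans lt_c) // count_size.
Qed.

Lemma ballot_tab B : ballot B ->
  [/\ two_rowed (tab_of B), is_standard (tab_of B) & tops (tab_of B) = B].
Proof.
move=> bB; pose r0 := enum (~: B); pose r1 := enum B.
have sz : size r1 <= size r0.
  rewrite -!cardE; case: (posnP #|B|) => [->//|B_gt0].
  have /card_gt0P[x0 _] := B_gt0.
  (* The last element of [B] compares the lengths of the two rows. *)
  by have [] := ballot_nth x0 (j := #|B|.-1) bB; rewrite prednK.
have zipP : all (fun p : 'I_n * 'I_n => p.1 < p.2) (zip r0 r1).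
  apply/allP=> -[x y] /(nthP (x, y))[j]; rewrite size_zip (minn_idPr sz) => lt_j.
  rewrite nth_zip_cond size_zip (minn_idPr sz) lt_j => -[<- <-] /=.
  rewrite (set_nth_default x y lt_j).
  by have [] := ballot_nth x (j := j) bB; rewrite // cardE.
have nthE : (nth [::] (tab_of B) 0 = r0) * (nth [::] (tab_of B) 1 = r1).
  rewrite /tab_of /stack /= -/r0 -/r1.
  by case: r0 sz {zipP} => [|a r]; case: r1.
have flatE : flatten (tab_of B) = r0 ++ r1.
  rewrite /tab_of /stack /= -/r0 -/r1.
  by case: r0 sz {zipP nthE} => [|a r]; case: r1 => //= *; rewrite ?cats0.
have topsE : tops (tab_of B) = B.
  by apply/setP=> i; rewrite inE /top_row nthE mem_enum.
have t2 : two_rowed (tab_of B).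
  apply/andP; split; last first.
    by rewrite size_filter (leq_trans (count_size _ _)).
  apply/andP; split; last first.
    rewrite flatE uniq_perm ?enum_uniq //.
      rewrite cat_uniq !enum_uniq /= andbT; apply/hasPn=> i.
      by rewrite !mem_enum inE negbK.
    by move=> i; rewrite mem_cat !mem_enum !inE orNb.
  rewrite /tab_of /stack /is_partition /= -/r0 -/r1.
  by case: r0 sz {zipP nthE flatE} => [|a r]; case: r1 => //= *; rewrite ?inE ?andbT.
split=> //; apply/and3P; split; first by case/andP: t2.
- apply/allP=> r; rewrite mem_filter => /andP[_]; rewrite !inE.
  by case/orP => /eqP->; apply: sorted_enum_set.
- rewrite /tab_of /stack /= -/r0 -/r1.
  by case: r0 sz zipP {nthE flatE} => [|a r]; case: r1 => //= *; rewrite ?andbT.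
Qed.

End BallotSets.

(** * Straightening modulo the ideal *)

Section Straightening.
Local Open Scope ring_scope.
Variables (n mu1 mu2 : nat).
Hypotheses (le_mu : (mu2 <= mu1)%N) (mu_n : (mu1 + mu2 = n)%N).
Local Notation mu := [:: mu1; mu2].
Local Notation I_mu := (@gp_ideal n mu).
Implicit Types (t : seq (seq 'I_n)) (A B C D : {set 'I_n}).

Lemma gp_pi_ideal (p : {mpoly rat[n]}) : gp_pi mu p = 0 <-> p \in I_mu.
Proof. by rewrite -{1}(raddf0 (gp_pi mu)) gp_pi_eq subr0. Qed.

Lemma esym_recr A i d : i \in A ->
  esym A d.+1 = esym (A :\ i) d.+1 + 'X_i * esym (A :\ i) d.
Proof.
move=> iA; rewrite !esymE (bigID (fun B => i \in B)) /= addrC; congr (_ + _).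
  apply: eq_bigl => B; rewrite subsetD1.
  by rewrite -andbA [(_ == _) && _]andbC andbA.
rewrite mulr_sumr (reindex_onto (fun B => i |: B) (fun B => B :\ i)) /=; last first.
  by move=> B /andP[_ iB]; rewrite setD1K.
apply: eq_big => [B|B].
  rewrite subUset sub1set iA /= setU11 andbT subsetD1.
  case: (boolP (i \in B)) => iB.
    rewrite andbF /=; apply/negbTE; rewrite negb_and; apply/orP; right.
    by apply: contraTneq iB => <-; rewrite !inE eqxx.
  by rewrite setU1K // eqxx !andbT cardsU1 iB add1n eqSS.
move=> /andP[_ /eqP BE]; rewrite /xset big_setU1 //.
by rewrite -BE !inE eqxx.
Qed.

Lemma esym0 A : esym A 0 = 1.
Proof.
rewrite esymE (big_pred1 set0) => [|B]; first by rewrite /xset big_set0.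
by rewrite cards_eq0 /= andb_idl // => /eqP->; apply: sub0set.
Qed.

(** With X the set of all variables, x_i^2 = x_i e_1(X) - e_2(X) + e_2(X minus x_i), and all three
    elementary symmetric polynomials are generators. *)
Lemma sqr_gp_ideal (i : 'I_n) : 'X_i ^+ 2 \in I_mu.
Proof.
have n_gt0 : (0 < n)%N := leq_trans (ltn0Sn _) (ltn_ord i).
have iT : i \in setT by rewrite inE.
have -> : 'X_i ^+ 2 = 'X_i * esym setT 1 - (esym setT 2 - esym (setT :\ i) 2).
  rewrite (esym_recr 1 iT) [esym setT 1](esym_recr 0 iT) esym0 mulr1.
  by rewrite [X in _ - X]addrAC subrr add0r mulrDr addrAC subrr add0r expr2.
have cT : #|[set: 'I_n]| = n by rewrite cardsT card_ord.
have cTi : #|[set: 'I_n] :\ i| = n.-1.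
  by have := cardsD1 i [set: 'I_n]; rewrite iT cT add1n => /(congr1 predn) /= ->.
apply: rpredB; first (apply: gp_idealMl; apply: gp_generator_esym => //; rewrite cT; lia).
apply: rpredB; apply: gp_generator_esym => //; rewrite ?cT ?cTi; lia.
Qed.

(** x_B is e_d(B) for d = [#|B|], a generator as soon as n - d < [mu1], that is, [mu2] < d. *)
Lemma xset_gp_ideal B : (mu2 < #|B|)%N -> xset B \in I_mu.
Proof.
move=> lt_B; have := max_card B; rewrite card_ord => leBn.
have -> : xset B = esym B #|B|.
  rewrite esymE (big_pred1 B) // => C; apply/andP/eqP => [[CB /eqP cC]|->//].
  by apply/eqP; rewrite eqEcard CB /= cC leqnn.
by rewrite gp_generator_esym //; lia.
Qed.

Lemma mpolyX_gp_ideal (m : 'X_{1..n}) i : (1 < m i)%N -> 'X_[m] \in I_mu.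
Proof.
move=> mi; have -> : m = ((m - U_(i) *+ 2) + U_(i) *+ 2)%MM.
  apply/mnmP=> j; rewrite mnmDE mnmBE mulmnE mnm1E.
  by case: eqP => [<-|_]; lia.
by rewrite mpolyXD -mpolyXn gp_idealMl // sqr_gp_ideal.
Qed.

Lemma xsetM_gp_ideal B C : ~~ [disjoint B & C] -> xset B * xset C \in I_mu.
Proof.
rewrite -setI_eq0 => /set0Pn[i /setIP[iB iC]].
rewrite !xsetE -mpolyXD; apply: (@mpolyX_gp_ideal _ i).
by rewrite mnmDE !mnmE iB iC.
Qed.

Lemma weightU B C : [disjoint B & C] -> weight (B :|: C) = (weight B + weight C)%N.
Proof. by move=> dBC; rewrite /weight -bigU //=; apply: eq_bigl => i; rewrite !inE. Qed.

(** [D :\: C] and [C :\: D] are nonempty of equal size; the elements of the former exceed [b], those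
    of the latter do not. *)
Lemma weight_lt C D b : #|D| = #|C| -> D != C -> {in C, forall i : 'I_n, (i <= b)%N} ->
  {in D :\: C, forall i : 'I_n, (b < i)%N} -> (weight C < weight D)%N.
Proof.
move=> cDC neDC leC gtD.
have splitw A A' : weight A = (weight (A :&: A') + weight (A :\: A'))%N.
  rewrite -weightU ?setID // -setI_eq0; apply/eqP/setP=> i.
  by rewrite !inE; case: (i \in A'); rewrite ?andbF.
have cD0 : (0 < #|D :\: C|)%N.
  rewrite card_gt0; apply: contraNneq neDC => /eqP; rewrite setD_eq0 => DC.
  by rewrite eqEcard DC cDC leqnn.
have cDD : #|C :\: D| = #|D :\: C|.
  by have := cardsID C D; have := cardsID D C; rewrite setIC; lia.
rewrite (splitw C D) (splitw D C) setIC ltn_add2l.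
have le1 : (weight (C :\: D) <= #|C :\: D| * b)%N.
  rewrite /weight -sum_nat_const; apply: leq_sum => i; rewrite inE => /andP[_ /leC//].
have le2 : (#|D :\: C| * b.+1 <= weight (D :\: C))%N.
  by rewrite /weight -sum_nat_const; apply: leq_sum => i /gtD.
move: le1 le2; rewrite cDD; nia.
Qed.

(* For a witness b that B is not ballot, let C be the part of B up to b and A
   the complement of the entries below b that are not in B: modulo e_|C|(A),
   x_C is a combination of monomials x_D with D of larger weight. *)
Lemma ballot_span B :
  span (fun v => exists C, [/\ ballot C, #|C| = #|B| & v = gp_pi mu (xset C)])
    (gp_pi mu (xset B)).
Proof.
(* Weights are at most [n * n], so the induction can run towards larger weights. *)
have [N leN] := ubnP (n * n - weight B); elim: N B leN => // N IH B leN.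
have [bB|] := boolP (ballot B); first by apply: mem_span; exists B.
have [lt_B _|leB] := ltnP mu2 #|B|.
  by have /gp_pi_ideal-> := xset_gp_ideal lt_B; apply: span0.
rewrite negb_forall_in => /existsP[b /andP[bB]]; rewrite -ltnNge.
set Z := [set a in ~: B | _]; set C := [set c in B | _] => ltZC.
have CB : C \subset B by apply/subsetP=> c; rewrite inE => /andP[].
have CA : C \subset ~: Z.
  by apply/subsetP=> c /(subsetP CB) cB; rewrite !inE cB.
have := cardsC Z; rewrite card_ord => cZ.
(* As [#|Z|] < [#|C|] <= [#|B|] <= [mu2], the generator condition amounts to [ltZC]. *)
have eI : esym (~: Z) #|C| \in I_mu.
  by apply: gp_generator_esym => //; have := subset_leq_card CB; lia.
have dBC : [disjoint B :\: C & C].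
  by rewrite -setI_eq0; apply/eqP/setP=> i; rewrite !inE; case: (i \in B); case: (_ <= _)%N.
have BE : (B :\: C) :|: C = B.
  by rewrite setUC -{1}(setIidPr CB) setID.
have := gp_idealMl (xset (B :\: C)) eI.
rewrite esymE (bigD1 C) /= ?CA ?eqxx // mulrDr -xsetD // BE => relI.
set rest := \sum_(D | _) _ in relI.
have -> : gp_pi mu (xset B) = - gp_pi mu (xset (B :\: C) * rest).
  by rewrite -raddfN; apply/gp_pi_eq; rewrite opprK.
rewrite -scaleN1r; apply: spanZ; rewrite /rest mulr_sumr raddf_sum.
apply: span_sum => D /andP[/andP[DA /eqP cD] neD].
have [dD|] := boolP [disjoint B :\: C & D]; last first.
  by move/xsetM_gp_ideal/gp_pi_ideal => E0; rewrite /= E0; apply: span0.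
have -> : #|B| = #|B :\: C :|: D|.
  have cU A A' : [disjoint A & A'] -> #|A :|: A'| = (#|A| + #|A'|)%N.
    by move=> dA; apply/eqP; rewrite (leq_card_setU A A').2.
  by rewrite -{1}BE !cU ?cD.
rewrite /= -xsetD //; apply: IH; rewrite weightU //.
have wB : weight B = (weight (B :\: C) + weight C)%N by rewrite -weightU ?BE.
suff : (weight C < weight D)%N.
  by move=> lt_w; have := weight_bound (B :\: C :|: D); rewrite weightU //; lia.
(* An element of [D] outside [C] exceeds [b]: if it is in [B], because it is not in [C]; otherwise
   because it is not in [Z] and differs from [b]. *)
apply: (@weight_lt _ _ b) => // [i|i]; first by rewrite inE => /andP[].
rewrite !inE negb_and -ltnNge => /andP[+ /(subsetP DA)]; rewrite !inE.
case: (boolP (i \in B)) => //= iB _; rewrite -leqNgt leq_eqVlt => /orP[/eqP/val_inj E|//].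
by rewrite -E bB in iB.
Qed.

(** The standard Specht polynomials of degree [#|B|] are indexed by the ballot sets of that size.
    They are independent modulo the ideal and lie in the span of the ballot monomials, so
    [span_of_free] inverts the relation. *)
Lemma standard_span B : (#|B| <= mu2)%N ->
  span (fun v => exists t, [/\ two_rowed t, is_standard t, #|tops t| = #|B|
                              & v = gp_pi mu (specht_poly t)])
    (gp_pi mu (xset B)).
Proof.
move=> leB; pose W := [set C : {set 'I_n} | ballot C && (#|C| == #|B|)].
pose T (i : 'I_#|W|) := tab_of (enum_val i : {set 'I_n}).
have T_prop (i : 'I_#|W|) : [/\ two_rowed (T i), is_standard (T i), 
    tops (T i) = enum_val i & #|tops (T i)| = #|B|].
  have := enum_valP i; rewrite inE => /andP[/ballot_tab[t2 st tE] /eqP cE].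
  by split; rewrite ?tE.
have WP C : ballot C -> #|C| = #|B| -> exists i : 'I_#|W|, C = enum_val i.
  move=> bC cC; have CW : C \in W by rewrite inE bC cC eqxx.
  by exists (enum_rank_in CW C); rewrite enum_rankK_in.
have ballotW C : #|C| = #|B| ->
    span (fun v => exists i : 'I_#|W|, v = gp_pi mu (xset (enum_val i))) (gp_pi mu (xset C)).
  move=> cC; have := ballot_span C; apply: sub_span => _ [D [bD cD ->]].
  by have [i ->] := WP D bD (etrans cD cC); apply: mem_span; exists i.
have freeW (c : 'I_#|W| -> rat) : \sum_i c i *: gp_pi mu (specht_poly (T i)) = 0 ->
    forall i, c i = 0.
  under eq_bigr => i _ do rewrite -linearZ.
  rewrite -linear_sum => /gp_pi_ideal cI i.
  apply: (specht_free (s := enum 'I_#|W|) (T := T)); rewrite ?enum_uniq ?mem_enum //.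
  - move=> j k _ _ E; apply: enum_val_inj.
    by have [_ _ <- _] := T_prop j; have [_ _ <- _] := T_prop k; rewrite E.
  - by move=> j _; have [] := T_prop j.
  - rewrite big_enum; apply: (specht_ideal0 le_mu mu_n) => //.
    apply: span_sum => j _; apply/spanZ/mem_span; exists (T j).
    by have [? _ _ cE] := T_prop j; rewrite cE.
have specht_W i : span (fun v => exists j : 'I_#|W|, v = gp_pi mu (xset (enum_val j)))
    (gp_pi mu (specht_poly (T i))).
  rewrite raddf_sum; apply: span_sum => tau _; rewrite /= linearZ; apply: spanZ.
  apply: ballotW; rewrite card_imset; last exact: perm_inj.
  by have [] := T_prop i.
have := ballot_span B; apply: sub_span => _ [C [bC cC ->]].
have [i ->] := WP C bC cC.
have := span_of_free specht_W freeW i; apply: sub_span => _ [j ->].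
apply: mem_span; exists (T j).
by have [? ? _ ?] := T_prop j.
Qed.

(** Monomials with a square factor or of degree above [mu2] vanish in the quotient; the others fall
    under [standard_span]. *)
Lemma standard_span_all (p : {mpoly rat[n]}) :
  span (fun v => exists t, [/\ two_rowed t, is_standard t, (#|tops t| <= mu2)%N
                              & v = gp_pi mu (specht_poly t)])
    (gp_pi mu p).
Proof.
rewrite (mpolyE p) raddf_sum; apply: span_sum => m _; rewrite /= linearZ /=.
apply: spanZ.
have [/forallP sq|] := boolP [forall i, (m i <= 1)%N]; last first.
  rewrite negb_forall => /existsP[i]; rewrite -ltnNge => /mpolyX_gp_ideal/gp_pi_ideal->.
  exact: span0.
have -> : m = mset [set i | m i == 1%N].
  by apply/mnmP=> i; rewrite mnmE inE; have := sq i; case: (m i) => [|[]].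
rewrite -xsetE; set B := [set i | _].
have [lt_B|leB] := ltnP mu2 #|B|.
  by have /gp_pi_ideal-> := xset_gp_ideal lt_B; apply: span0.
have := standard_span leB; apply: sub_span => _ [t [t2 st cE ->]].
by apply: mem_span; exists t; rewrite cE.
Qed.

End Straightening.

(** * Catabolizability types with two rows *)

Section CtypeTwoRows.
Implicit Types (w x nu : seq nat).

Lemma cat_step_rcons x a nu : cat_step (rcons x a, nu) =
  if is_partition (incr_nth nu a) then (x, incr_nth nu a) else (a.+1 :: x, nu).
Proof. by case: x => [|b x] //=; rewrite ?belast_rcons ?last_rcons. Qed.

(* A letter only grows while it moves, hence it ends in a row at least as high
   as its initial label. *)
Lemma iter_cat_step_high k x nu x' nu' :
    iter k cat_step (x, nu) = (x', nu') -> is_partition nu ->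
    has (leq 2) x || (2 < size nu) ->
  [/\ is_partition nu', size x' + sumn nu' = size x + sumn nu
    & has (leq 2) x' || (2 < size nu')].
Proof.
elim: k x nu => [|k IH] x nu; first by case=> -> ->.
rewrite iterSr; case: (lastP x) => [|{}x a]; first exact: IH.
have sumn_incr : sumn (incr_nth nu a) = (sumn nu).+1.
  elim: nu a {IH} => [|b nu IH] [|a] //=; last by rewrite IH addnS.
  by elim: a => //= a; rewrite /incr_nth /= => ->.
rewrite cat_step_rcons has_rcons size_rcons; case: ifP => pa /IH {}IH pnu high.
  have [||p' cnt hi] := IH => //; last first.
    by split=> //; rewrite cnt sumn_incr addnS.
  rewrite size_incr_nth; case: (has _ x) high => //; rewrite orbF.
  by case: (ltnP a (size nu)); lia.
have [//||p' cnt hi] := IH; last by split=> //; rewrite cnt /= addSn.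
by move: high => /=; case: (has _ x); rewrite ?orbT ?orbF //; lia.
Qed.

(** The parts of [nu] sum to [size w], so the hypothesis leaves no third row, and by
    [iter_cat_step_high] no letter above 1 may ever occur. This is applied to the initial word and
    to the word after one step. *)
Lemma ctype_two_rows w nu : ctype w = Some nu -> size w <= sumn (take 2 nu) ->
  all (fun c => c <= 1) (cc_word w) /\ last 0 (cc_word w) = 0.
Proof.
move=> /ctypeP[k kE] le_nu.
have low m x : iter m cat_step (x, [::]) = ([::], nu) -> size x = size w ->
    ~~ has (leq 2) x.
  move=> mE szx; apply/negP => high.
  have [||/andP[_ nz]] := iter_cat_step_high mE => //; rewrite ?high //= addn0 szx.
  case: nu le_nu nz {kE mE} => [|a [|b [|c nu]]] //=.
  by rewrite !inE !negb_or => le_nu /and4P[_ _ c0 _] E; move: le_nu; rewrite -E; lia.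
have low0 : all (fun c => c <= 1) (cc_word w).
  have := low k _ kE; rewrite size_map => /(_ erefl); rewrite -all_predC.
  by apply: sub_all => c /=; rewrite -ltnNge.
have szw : size (cc_word w) = size w by rewrite size_map.
split=> //; case: (lastP (cc_word w)) kE low0 szw => // x a.
case: k => [|k]; first by case: x.
rewrite iterSr cat_step_rcons last_rcons all_rcons size_rcons => + /andP[le_a _] sz.
(* A last letter 1 cannot be placed on the empty partition: the first step would turn it into a
   2. *)
case: a le_a => [|[|]] //= _ /low /=.
by rewrite sz => /(_ erefl).
Qed.

(** [nseq (0 < i) i] is the partition with the single part [i], empty for [i = 0]; each trailing 0
    lengthens the first row. *)
Lemma iter_cat_step_zeros x i j :
  iter j cat_step (x ++ nseq j 0, nseq (0 < i) i) = (x, nseq (0 < i + j) (i + j)).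
Proof.
elim: j i => [|j IH] i; first by rewrite cats0 addn0.
rewrite iterSr -addn1 nseqD catA cats1 cat_step_rcons.
have -> : incr_nth (nseq (0 < i) i) 0 = nseq (0 < i.+1) i.+1 by case: i.
by rewrite IH addn1 addSnnS.
Qed.

Lemma iter_cat_step_ones m i j : 0 < m -> i + j <= m ->
  iter j cat_step (nseq j 1, m :: nseq (0 < i) i) = ([::], m :: nseq (0 < i + j) (i + j)).
Proof.
move=> m_gt0; elim: j i => [|j IH] i le_m; first by rewrite addn0.
rewrite iterSr -addn1 nseqD cats1 cat_step_rcons.
have -> : incr_nth (m :: nseq (0 < i) i) 1 = m :: nseq (0 < i.+1) i.+1 by case: i {le_m}.
have -> : is_partition (m :: nseq (0 < i.+1) i.+1).
  by rewrite /is_partition /= /geq /= !inE; lia.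
by rewrite IH ?addn1 addSnnS.
Qed.

(** The reading word of S_d for n = m + d, with letters counted from 0. *)
Definition two_row_word m d := iota m d ++ iota 0 m.

Lemma index_iota a b k : a <= k < a + b -> index k (iota a b) = k - a.
Proof.
move=> /andP[le_a lt_k]; rewrite -{1}(subnKC le_a) -(@nth_iota 0 a b); last lia.
by rewrite index_uniq ?iota_uniq ?size_iota //; lia.
Qed.

(** The only letter to the left of its predecessor is [m], and it has a predecessor only if [m] is
    positive. *)
Lemma cc_label_two_row m d k : k < m + d -> cc_label (two_row_word m d) k = (0 < m <= k).
Proof.
have idx i : i < m + d -> index i (two_row_word m d) = if m <= i then i - m else d + i.
  move=> lt_i; rewrite index_cat mem_iota lt_i andbT size_iota.
  by case: leqP => le_m; rewrite index_iota ?subn0 // le_m.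
elim: k => [|k IH] lt_k /=; first by lia.
rewrite IH ?idx //; try exact: ltnW.
by case: (leqP m k); case: (leqP m k.+1); lia.
Qed.

Lemma ctype_two_row m d : d <= m ->
  ctype (two_row_word m d) = Some [seq k <- [:: m; d] | 0 < k].
Proof.
move=> le_d; apply/ctypeP.
have [m0|m_gt0] := posnP m.
  by exists 0; move: le_d; rewrite m0 leqn0 => /eqP->.
have ccE : cc_word (two_row_word m d) = nseq d 1 ++ nseq m 0.
  have constE s c : all (fun k => cc_label (two_row_word m d) k == c) s ->
      map (cc_label (two_row_word m d)) s = nseq (size s) c.
    by move=> sc; rewrite -[in RHS](size_map (cc_label (two_row_word m d)));
       apply/all_pred1P; rewrite all_map.
  rewrite /cc_word map_cat; congr (_ ++ _).
    rewrite (constE _ 1) ?size_iota //; apply/allP=> k.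
    by rewrite mem_iota => /andP[le_k lt_k]; rewrite cc_label_two_row // m_gt0 le_k.
  rewrite (constE _ 0) ?size_iota //; apply/allP=> k.
  by rewrite mem_iota => lt_k; rewrite cc_label_two_row; lia.
exists (d + m); rewrite iterD ccE (iter_cat_step_zeros _ 0) add0n.
have -> : nseq (0 < m) m = m :: nseq (0 < 0) 0 by rewrite m_gt0.
by rewrite iter_cat_step_ones // add0n /= m_gt0; case: (d).
Qed.

End CtypeTwoRows.

(** * Recognizing the tableaux S_d by their cocharge labels *)

Section SigmaTwoRows.
Variable n : nat.
Implicit Types (t : seq (seq 'I_n)) (r : seq 'I_n) (B C : {set 'I_n}).

Lemma reading_rows t : two_rowed t -> reading_word t = top_row t ++ bottom_row t.
Proof. by case: t => [|r0 [|r1 [|r2 t]]] /andP[] //= _ _; rewrite /reading_word /= ?cats0. Qed.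

Lemma val_sorted_row r a b : sorted (@ord_lt n) r -> a + b <= n ->
  (forall i : 'I_n, (i \in r) = (a <= i < a + b)) -> map val r = iota a b.
Proof.
move=> sr le_ab rE; apply: (irr_sorted_eq ltn_trans ltnn).
- by rewrite sorted_map.
- exact: iota_ltn_sorted.
move=> k; rewrite mem_iota; apply/mapP/idP => [[i ir ->]|kab]; first by rewrite -rE.
have lt_k : k < n by lia.
by exists (Ordinal lt_k); rewrite ?rE.
Qed.

(** Ordinals count from 0, so these are the entries n-d+1, ..., n, the top row of S_d. *)
Definition last_entries d : {set 'I_n} := [set i : 'I_n | n - d <= i].

Lemma val_rows t d : two_rowed t -> is_standard t -> d <= n -> tops t = last_entries d ->
  (map val (top_row t) = iota (n - d) d) * (map val (bottom_row t) = iota 0 (n - d)).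
Proof.
move=> t2 st le_d tE; split; apply: val_sorted_row; rewrite ?standard_row_sorted //; try lia.
- by move=> i; have /setP/(_ i) := tE; rewrite !inE => ->; have := ltn_ord i; lia.
- by move=> i; rewrite mem_bottom // tE inE; lia.
Qed.

Lemma card_last_entries d : d <= n -> #|last_entries d| = d.
Proof.
move=> le_d; rewrite -[RHS](size_iota (n - d)) -(val_sorted_row (r := enum (last_entries d))).
- by rewrite size_map -cardE.
- exact: sorted_enum_set.
- lia.
- by move=> i; rewrite mem_enum inE; have := ltn_ord i; lia.
Qed.

Lemma ctype_last_entries t d : two_rowed t -> is_standard t -> d + d <= n ->
  tops t = last_entries d ->
  ctype (map val (reading_word t)) = Some [seq k <- [:: n - d; d] | 0 < k].
Proof.
move=> t2 st le_d tE; rewrite reading_rows // map_cat !(val_rows t2 st _ tE); try lia.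
by rewrite ctype_two_row //; lia.
Qed.

Lemma cc_tableau_last_entries t d : two_rowed t -> is_standard t -> d + d <= n ->
  tops t = last_entries d ->
  cc_tableau t = [seq [seq nat_of_bool (i \in tops t) | i <- r] | r <- t].
Proof.
move=> t2 st le_d tE; apply: eq_map => r; apply: eq_map => i.
rewrite reading_rows // map_cat !(val_rows t2 st _ tE); try lia.
rewrite tE inE -[val i]/(nat_of_ord i); have lt_i := ltn_ord i.
by rewrite cc_label_two_row; lia.
Qed.

Lemma standard_above_bottom t i y : is_standard t -> y \in nth [::] t i.+1 ->
  exists2 x, x \in nth [::] t 0 & x < y.
Proof.
move=> st; elim: i y => [|i IH] y yt; have [xt xy] := standard_below st yt.
  by exists (nth y (nth [::] t 0) (index y (nth [::] t 1))).
by have [z z0 zx] := IH _ xt; exists z; rewrite // (ltn_trans zx).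
Qed.

Lemma cc_label_mono w k k' : k <= k' -> cc_label w k <= cc_label w k'.
Proof.
move=> /subnKC <-; elim: (k' - k) => [|m IH]; first by rewrite addn0.
by rewrite addnS /= (leq_trans IH) ?leq_addr.
Qed.

(** Labels are monotone, so no label rises between [k] and [k']: each letter is followed by its
    successor in reading order. *)
Lemma cc_label_eq_index w k k' : k <= k' -> cc_label w k = cc_label w k' ->
  index k w <= index k' w.
Proof.
move=> /subnKC <-; elim: (k' - k) => [|m IH]; rewrite ?addn0 // addnS => E.
have := cc_label_mono w (leq_addr m k); have := cc_label_mono w (leqnSn (k + m)).
rewrite -E => le1 le2; have Em : cc_label w k = cc_label w (k + m) by lia.
apply: leq_trans (IH Em) _; rewrite leqNgt; apply/negP => lt_i.
by move: E; rewrite /= -Em lt_i; lia.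
Qed.

Lemma index_cat_lt (T : eqType) (a b : seq T) (x y : T) : uniq (a ++ b) ->
  x \in b -> y \in a -> index y (a ++ b) < index x (a ++ b).
Proof.
rewrite cat_uniq => /and3P[_ /hasPn ab _] xb ya; rewrite !index_cat ya (negPf (ab x xb)).
by rewrite ltn_addr // index_mem.
Qed.

Lemma card_ltn_ord m : m <= n -> #|[set i : 'I_n | i < m]| = m.
Proof.
move=> le_m; have -> : [set i : 'I_n | i < m] = ~: last_entries (n - m).
  by apply/setP=> i; rewrite !inE; lia.
by rewrite cardsCs setCK card_ord card_last_entries ?leq_subr // subKn.
Qed.

(* If all labels are at most 1 and the last one is 0, then the letters labelled
   0 form the bottom row, and those labelled 1 read left to right, which leaves
   room for a single further row. *)
Lemma cc_two_labels t (w := map val (reading_word t)) : is_standard t ->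
    all (fun c => c <= 1) (cc_word w) -> last 0 (cc_word w) = 0 ->
  two_rowed t /\ tops t = last_entries #|tops t|.
Proof.
rewrite {}/w => st lab1 lab0; set w := map val _ in lab1 lab0.
have /andP[/andP[_ nz] perm_t] : is_tableau t by case/and3P: st.
have perm_w : perm_eq (reading_word t) (enum 'I_n).
  by apply: perm_trans perm_t; apply: perm_flatten; rewrite perm_rev.
have uniq_w : uniq (reading_word t) by rewrite (perm_uniq perm_w) enum_uniq.
have mem_w i : i \in reading_word t by rewrite (perm_mem perm_w) mem_enum.
have indexE (i : 'I_n) : index (val i) w = index i (reading_word t).
  by rewrite index_map //; apply: val_inj.
have lab_le (i : 'I_n) : cc_label w (val i) <= 1.
  by apply: (allP lab1); apply/map_f/map_f/mem_w.
case: t => [|r0 rest] in st w lab1 lab0 nz perm_t perm_w uniq_w mem_w indexE lab_le *.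
  split; first by apply/andP; split=> //; case/and3P: st.
  by apply/setP=> i; have := mem_w i.
pose u := flatten (rev rest).
have wE : reading_word (r0 :: rest) = u ++ r0.
  by rewrite /reading_word rev_cons flatten_rcons.
have sorted_r0 : sorted (@ord_lt n) r0 := standard_row_sorted 0 st.
(* The last letter of the reading word is the largest entry of the bottom row; its label 0 bounds
   the labels of the whole row. *)
have bottom0 (i : 'I_n) : i \in r0 -> cc_label w (val i) = 0.
  move=> ir0; have [r [z r0E]] : exists r z, r0 = rcons r z.
    by case/lastP: (r0) ir0 => // r z _; exists r, z.
  have zE : cc_label w (val z) = 0.
    transitivity (last 0 (cc_word w)) => //.
    by rewrite /cc_word /w wE r0E -rcons_cat !map_rcons last_rcons.
  move: ir0 sorted_r0; rewrite r0E mem_rcons inE => /orP[/eqP->//|ir].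
  rewrite (sorted_pairwise (@ord_lt_trans n)) pairwise_rcons => /andP[/allP/(_ i ir) iz _].
  by apply/eqP; rewrite -leqn0 -zE cc_label_mono // ltnW.
(* Induction on the letter: the smallest is in the bottom row, and if [k] is there and [k.+1] still
   has label 0, then [k.+1] is not read before [k], whereas all upper rows are. *)
have label0 (i : 'I_n) : cc_label w (val i) = 0 -> i \in r0.
  case: i => k /=; elim: k => [|k IH] lt_k.
    move=> _; have := mem_w (Ordinal lt_k); rewrite wE mem_cat => /orP[|//].
    case/flattenP => r; rewrite mem_rev => /(nthP [::])[j _ <-] iu.
    by have [x _] := @standard_above_bottom _ j _ st iu.
  rewrite /= => /eqP; rewrite addn_eq0 => /andP[/eqP/(IH (ltnW lt_k)) kr0].
  have := mem_w (Ordinal lt_k); rewrite wE mem_cat => /orP[ku|//].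
  rewrite wE in uniq_w; have := index_cat_lt uniq_w kr0 ku.
  by rewrite -wE -!indexE /= => ->.
have disj i : i \in r0 -> i \notin u.
  by move: uniq_w; rewrite wE cat_uniq => /and3P[_ /hasPn + _] => /(_ i).
(* An entry [y] of a third row and the smaller [x] below it would both have label 1, so [x] would be
   read before [y]; but higher rows are read first. *)
have sz : size (r0 :: rest) <= 2.
  case restE : rest => [|r1 [|r2 rest']] //; rewrite restE in st nz.
  have uE : u = (flatten (rev rest') ++ r2) ++ r1.
    by rewrite /u restE !rev_cons !flatten_rcons.
  have [y yr2] : exists y, y \in r2.
    case: (r2) nz => [|y r]; first by rewrite /= !inE eqxx !orbT.
    by exists y; rewrite mem_head.
  have [] := @standard_below _ _ 1 y st yr2; set x := nth y _ _ => /= xr1 xy.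
  have lab1E (i : 'I_n) : i \in u -> cc_label w (val i) = 1.
    have := lab_le i; case E : (cc_label w (val i)) => [|[]] //.
    by move/label0: E => /disj/negPf->.
  have [xu yu] : x \in u /\ y \in u by rewrite uE !mem_cat xr1 yr2 !orbT.
  have := cc_label_eq_index (ltnW xy) (etrans (lab1E x xu) (ssrfun.esym (lab1E y yu))).
  rewrite !indexE wE !index_cat xu yu leqNgt uE index_cat_lt // ?mem_cat ?yr2 ?orbT //.
  by rewrite -uE; move: uniq_w; rewrite wE cat_uniq => /andP[].
have t2 : two_rowed (r0 :: rest) by apply/andP; split=> //; case/and3P: st.
split=> //; apply/setP=> i; rewrite [RHS]inE -size_bottom //.
rewrite -[LHS]negbK -mem_bottom // /bottom_row /=.
(* By monotonicity of labels the bottom row is an initial segment of the entries, hence determined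
   by its size. *)
have downclosed (j k : 'I_n) : j \in r0 -> k <= j -> k \in r0.
  by move=> /bottom0 lab_j /(cc_label_mono w); rewrite lab_j leqn0 => /eqP/label0.
have card_r0 : #|[set j in r0]| = size r0.
  rewrite cardsE; apply/card_uniqP; move: uniq_w; rewrite wE cat_uniq.
  by case/and3P.
rewrite -card_r0.
case: (boolP (i \in r0)) => ir0 /=.
  apply/ssrfun.esym/negbTE; rewrite -ltnNge -(card_ltn_ord (ltn_ord i)).
  apply/subset_leq_card/subsetP=> j; rewrite !inE ltnS; exact: downclosed.
apply/ssrfun.esym; rewrite -(card_ltn_ord (ltnW (ltn_ord i))).
apply/subset_leq_card/subsetP=> j; rewrite !inE ltnNge => jr0.
by apply: contra ir0; apply: downclosed.
Qed.

End SigmaTwoRows.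

(** * The higher Specht basis *)

Section HigherSpechtTwoRows.
Local Open Scope ring_scope.
Variables (n mu1 mu2 : nat).
Hypotheses (le_mu : (mu2 <= mu1)%N) (mu_n : (mu1 + mu2 = n)%N).
Local Notation mu := [:: mu1; mu2].
Implicit Types (S T t : seq (seq 'I_n)) (B C : {set 'I_n}).

Lemma tops_double t : two_rowed t -> (#|tops t| + #|tops t| <= n)%N.
Proof.
move=> t2; have := size_rows t2; rewrite -card_tops // size_bottom //.
by have := max_card (tops t); rewrite card_ord; lia.
Qed.

Lemma two_rowed_shape S T : two_rowed S -> is_standard T -> shape S = shape T -> two_rowed T.
Proof.
move=> /andP[_ szS] /and3P[tT _ _] E; apply/andP; split=> //.
by have := congr1 size E; rewrite !size_map => <-.
Qed.

Lemma ballot_last_entries d : (d + d <= n)%N -> ballot (last_entries n d).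
Proof.
move=> le_d; apply/forall_inP => b; rewrite inE => le_b.
apply: (@leq_trans d).
  rewrite -{2}(@card_last_entries n d); last by lia.
  by apply/subset_leq_card/subsetP=> c; rewrite inE => /andP[].
apply: (@leq_trans (n - d)); first by lia.
rewrite -(@card_ltn_ord n (n - d)) ?leq_subr //.
by apply/subset_leq_card/subsetP=> c; rewrite !inE; lia.
Qed.

Lemma mem_Sigma (S : syt n) : two_rowed (val S) ->
  tops (val S) = last_entries n #|tops (val S)| -> (#|tops (val S)| <= mu2)%N ->
  S \in Sigma mu.
Proof.
move=> S2 SE le_d; have le_dd := tops_double S2.
rewrite unfold_in (ctype_last_entries S2 (valP S) le_dd SE).
set d := #|_| in le_d le_dd *; rewrite /dominates.
have : all (fun k => sumn (take k mu) <= sumn (take k [seq x <- [:: n - d; d] | 0 < x]))%N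
    [:: 0; 1; 2]%N.
  by rewrite /=; case: (posnP (n - d)) => e; case: (posnP d) => e' /=; rewrite ?e' /=; lia.
suff -> : maxn (size mu) (size [seq x <- [:: n - d; d] | 0 < x])%N = 2%N by [].
by rewrite /=; case: (posnP (n - d)); case: (posnP d).
Qed.

(** Dominance at k = 2 makes the first two parts of the type exhaust n, which triggers
    [ctype_two_rows]; dominance at k = 1 bounds the size of the top row by [mu2]. *)
Lemma Sigma_two_rowed (S : syt n) : S \in Sigma mu ->
  [/\ two_rowed (val S), tops (val S) = last_entries n #|tops (val S)|
    & (#|tops (val S)| <= mu2)%N].
Proof.
rewrite unfold_in; case E : (ctype _) => [nu|//]; rewrite /dominates => /allP dom.
have szw : size (map val (reading_word (val S))) = n.
  have perm_t : perm_eq (flatten (val S)) (enum 'I_n) by have /and3P[/andP[]] := valP S.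
  rewrite size_map -[RHS](size_enum_ord n) -(perm_size perm_t); apply: perm_size.
  by apply: perm_flatten; rewrite perm_rev.
have mem_iota2 k : (k <= 2)%N -> k \in iota 0 (maxn (size mu) (size nu)).+1.
  by move=> le_k; rewrite mem_iota add0n ltnS (leq_trans le_k) // leq_maxl.
have [|low last0] := ctype_two_rows E.
  by rewrite szw -mu_n; have := dom 2%N (mem_iota2 _ (leqnn _)); rewrite /= addn0.
have [S2 SE] := cc_two_labels (valP S) low last0.
split=> //; have le_dd := tops_double S2.
move: E; rewrite (ctype_last_entries S2 (valP S) le_dd SE); move: le_dd.
move: #|_| => d le_dd [nuE]; have := dom 1%N (mem_iota2 1%N isT); rewrite -nuE /=.
by case: (posnP (n - d)) => e; case: (posnP d) => e' /=; lia.
Qed.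

(** The shape determines d and thus S_d. In the basis, [S] is therefore determined by [T]. *)
Lemma Sigma_shape_inj (S S' : syt n) : S \in Sigma mu -> S' \in Sigma mu ->
  shape (val S) = shape (val S') -> S = S'.
Proof.
move=> /Sigma_two_rowed[S2 SE _] /Sigma_two_rowed[S2' SE' _] /eqP.
rewrite eq_shape // => /eqP E; apply: val_inj.
by apply: standard_tops_inj; rewrite ?(valP S) ?(valP S') // SE SE' E.
Qed.

Lemma Sigma_exists d : (d <= mu2)%N ->
  exists2 S : syt n, S \in Sigma mu & two_rowed (val S) /\ #|tops (val S)| = d.
Proof.
move=> le_d; have le_dd : (d + d <= n)%N by lia.
have [S2 st tE] := ballot_tab (ballot_last_entries le_dd).
have cE : #|last_entries n d| = d by apply: card_last_entries; lia.
exists (exist (@is_standard n) _ st : syt n); last by rewrite /= tE.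
by apply: mem_Sigma; rewrite /= ?tE ?cE.
Qed.

Lemma tableau_monomialE S T : two_rowed S -> two_rowed T -> shape S = shape T ->
  tableau_monomial T [seq [seq nat_of_bool (i \in tops S) | i <- r] | r <- S]
    = xset (tops T).
Proof.
move=> S2 T2 /eqP; rewrite eq_shape // => /eqP cE.
rewrite /tableau_monomial -map_flatten !flatten_rows // map_cat.
have szb : size (bottom_row T) = size (bottom_row S) by rewrite !size_bottom // cE.
have szt : size (top_row T) = size (top_row S) by rewrite -!card_tops.
rewrite zip_cat ?size_map // big_cat /=.
have prodE (s s' : seq 'I_n) (c : nat) : size s = size s' ->
    (forall i, i \in s' -> nat_of_bool (i \in tops S) = c) ->
    \prod_(p <- zip s [seq nat_of_bool (i \in tops S) | i <- s']) ('X_p.1 : {mpoly rat[n]}) ^+ p.2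
      = \prod_(i <- s) 'X_i ^+ c.
  elim: s s' => [|a s IH] [|b s'] //=; first by rewrite !big_nil.
  move=> [sz] s'c; rewrite !big_cons /= (s'c b) ?mem_head // IH // => i is'.
  by apply: s'c; rewrite inE is' orbT.
rewrite (prodE _ _ 0%N) //; last by move=> i; rewrite mem_bottom // => /negPf->.
rewrite (prodE _ _ 1%N) //; last by move=> i it; rewrite inE it.
rewrite big1 // mul1r /xset big_uniq; last first.
  by have := uniq_rows T2; rewrite cat_uniq => /and3P[].
by apply: eq_big => [i|i _]; rewrite ?inE ?expr1.
Qed.

Lemma row_stab_tops t (s : 'S_n) : two_rowed t -> s \in row_stab t -> s @: tops t = tops t.
Proof.
move=> t2; rewrite inE => /forallP st; apply/eqP; rewrite eqEcard.
rewrite card_imset; last exact: perm_inj.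
rewrite leqnn andbT; apply/subsetP=> _ /imsetP[i it ->].
by have := st i; rewrite !row_ofE // it; case: (_ \in _).
Qed.

(** The labels of [S] are 0 on the bottom row and 1 on the top row, so the monomial is x_B with B =
    [tops T]. Row permutations fix it, and the inner sum only multiplies by their number. *)
Lemma higher_spechtE (S : syt n) T : S \in Sigma mu -> two_rowed T ->
  shape (val S) = shape T ->
  higher_specht (val S) T = #|row_stab T|%:R *: specht_poly T.
Proof.
move=> /Sigma_two_rowed[S2 SE _] T2 E; rewrite /higher_specht /young_symmetrizer.
rewrite (cc_tableau_last_entries S2 (valP S) (tops_double S2) SE) tableau_monomialE //.
rewrite scaler_sumr; apply: eq_bigr => tau _.
under eq_bigr => s st do rewrite !msym_xset row_stab_tops //.
by rewrite sumr_const scaler_nat.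
Qed.

Lemma card_row_stab_neq0 T : #|row_stab T|%:R != 0 :> rat.
Proof.
rewrite pnatr_eq0 -lt0n; apply/card_gt0P; exists 1%g.
by rewrite inE; apply/forallP=> i; rewrite perm1.
Qed.

Lemma gp_pi_specht_poly (S : syt n) T : S \in Sigma mu -> two_rowed T ->
  shape (val S) = shape T ->
  gp_pi mu (specht_poly T) = #|row_stab T|%:R^-1 *: gp_pi mu (higher_specht (val S) T).
Proof.
move=> SS T2 E; rewrite (higher_spechtE SS T2 E) linearZ /= scalerA.
by rewrite mulVf ?scale1r ?card_row_stab_neq0.
Qed.

(** Up to nonzero scalars, the family lists once each Specht polynomial of a standard [T] of at most
    two rows whose top row has at most [mu2] entries. *)
Lemma specht_basis :
  is_basis (fun i : {ST : syt n * syt n |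
             (ST.1 \in Sigma mu) && (shape (val ST.1) == shape (val ST.2))} =>
    gp_pi mu (higher_specht (val (val i).1) (val (val i).2))).
Proof.
pose I := {ST : syt n * syt n |
  (ST.1 \in Sigma mu) && (shape (val ST.1) == shape (val ST.2))}.
have IP (i : I) : [/\ (val i).1 \in Sigma mu, two_rowed (val (val i).2),
    is_standard (val (val i).2), (#|tops (val (val i).2)| <= mu2)%N
    & shape (val (val i).1) = shape (val (val i).2)].
  have /andP[iS /eqP E] := valP i; have [S2 _ le_d] := Sigma_two_rowed iS.
  have T2 := two_rowed_shape S2 (valP (val i).2) E.
  split=> //; first exact: (valP (val i).2).
  by have /eqP := E; rewrite eq_shape // => /eqP <-.
have bE (i : I) : higher_specht (val (val i).1) (val (val i).2) =
    #|row_stab (val (val i).2)|%:R *: specht_poly (val (val i).2).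
  by have [iS T2 _ _ E] := IP i; apply: higher_spechtE.
split=> [s c us|v].
  under eq_bigr => i _ do rewrite -linearZ /= bE scalerA.
  rewrite -linear_sum => /gp_pi_ideal sI i si.
  apply: (mulIf (card_row_stab_neq0 (val (val i).2))); rewrite mul0r.
  apply: (specht_free (T := fun i : I => val (val i).2) us
    (c := fun i => c i * #|row_stab (val (val i).2)|%:R)) => // [j k sj sk E|j _|].
  - have [jS _ _ _ jE] := IP j; have [kS _ _ _ kE] := IP k; apply: val_inj.
    have E2 : (val j).2 = (val k).2 by apply: val_inj.
    have E1 : (val j).1 = (val k).1 by apply: Sigma_shape_inj => //; rewrite jE kE E.
    by rewrite [val j]surjective_pairing [val k]surjective_pairing E1 E2.
  - by have [] := IP j.
  - apply: (specht_ideal0 le_mu mu_n _ sI); apply: span_sum => j _.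
    by apply/spanZ/mem_span; exists (val (val j).2); have [] := IP j.
rewrite -[v]gp_reprK; have := standard_span_all le_mu mu_n (gp_repr v).
apply: sub_span => _ [t [t2 st le_t ->]].
have [S SS [S2 SE]] := Sigma_exists le_t.
have E : shape (val S) = shape t by apply/eqP; rewrite eq_shape // SE.
have iP : (S \in Sigma mu) && (shape (val S) == shape t) by rewrite SS E eqxx.
pose i : I := exist _ (S, exist (@is_standard n) t st) iP.
rewrite (gp_pi_specht_poly SS t2 E).
by apply/spanZ/mem_span; exists i.
Qed.

End HigherSpechtTwoRows.

(** * Specht modules *)

Section SpechtModules.
Local Open Scope ring_scope.
Variable n : nat.
Implicit Types (t : seq (seq 'I_n)) (B C : {set 'I_n}) (f : tabloid_module n).

(** The tabloid with top row [B]. The value 1 is a legitimate row index, since an entry [i] exists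
    only for positive [n]. *)
Definition indicator B : tabloid n := [ffun i => inord (i \in B)].

Lemma indicator_inj : injective indicator.
Proof.
move=> B C /ffunP E; apply/setP=> i; have := congr1 val (E i); rewrite !ffunE /= !inordK.
- by case: (i \in B); case: (i \in C).
- by have := ltn_ord i; case: (i \in C); lia.
- by have := ltn_ord i; case: (i \in B); lia.
Qed.

Lemma tabloid_ofE t : two_rowed t -> tabloid_of t = indicator (tops t).
Proof. by move=> t2; apply/ffunP=> i; rewrite !ffunE row_ofE. Qed.

Fact tabloid_act_is_linear (s : 'S_n) : linear (@tabloid_act n s).
Proof. by move=> a f g; apply/ffunP=> u; rewrite !ffunE. Qed.

HB.instance Definition _ (s : 'S_n) := GRing.isLinear.Build rat
  (tabloid_module n) (tabloid_module n) _ (@tabloid_act n s) (tabloid_act_is_linear s).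

Lemma tabloid_act_indicator (s : 'S_n) B :
  tabloid_act s (tabloid_vec (indicator B)) = tabloid_vec (indicator (s @: B)).
Proof.
apply/ffunP=> u; rewrite !ffunE; congr (nat_of_bool _)%:R.
apply/eqP/eqP => /ffunP E; apply/ffunP=> i; rewrite ffunE.
  have := E (s^-1%g i); rewrite !ffunE permKV => ->.
  by rewrite -[in RHS](permKV s i) mem_imset //; apply: perm_inj.
by rewrite E !ffunE mem_imset //; apply: perm_inj.
Qed.

Lemma polytabloidE t : two_rowed t -> polytabloid t =
  \sum_(tau in col_stab t) (-1) ^+ odd_perm tau *: tabloid_vec (indicator (tau @: tops t)).
Proof.
by move=> t2; apply: eq_bigr => tau _; rewrite tabloid_ofE // tabloid_act_indicator.
Qed.

(** The linear extension of {T} |-> x_B, B = [tops T]; values of [f] at maps other than indicators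
    are discarded. *)
Definition tabloid_poly f : {mpoly rat[n]} := \sum_B f (indicator B) *: xset B.

Fact tabloid_poly_is_linear : linear tabloid_poly.
Proof.
move=> a f g; rewrite /tabloid_poly scaler_sumr -big_split /=.
by apply: eq_bigr => B _; rewrite !ffunE scalerDl scalerA.
Qed.

HB.instance Definition _ := GRing.isLinear.Build rat
  (tabloid_module n) {mpoly rat[n]} _ tabloid_poly tabloid_poly_is_linear.

Lemma mcoeff_tabloid_poly f B : (tabloid_poly f)@_(mset B) = f (indicator B).
Proof.
rewrite raddf_sum (bigD1 B) //= mcoeffZ mcoeff_xset eqxx mulr1 big1 ?addr0 // => C CB.
by rewrite mcoeffZ mcoeff_xset (negPf CB) mulr0.
Qed.

Lemma tabloid_poly_indicator B : tabloid_poly (tabloid_vec (indicator B)) = xset B.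
Proof.
rewrite /tabloid_poly (bigD1 B) //= ffunE eqxx scale1r big1 ?addr0 // => C CB.
by rewrite ffunE (inj_eq indicator_inj) (negPf CB) scale0r.
Qed.

Lemma tabloid_poly_polytabloid t : two_rowed t ->
  tabloid_poly (polytabloid t) = specht_poly t.
Proof.
move=> t2; rewrite polytabloidE // linear_sum; apply: eq_bigr => tau _.
by rewrite /= linearZ /= tabloid_poly_indicator.
Qed.

Lemma tabloid_poly_act (s : 'S_n) f :
  tabloid_poly (tabloid_act s f) = msym s (tabloid_poly f).
Proof.
rewrite /tabloid_poly raddf_sum /= [RHS](reindex_inj (imset_inj (@perm_inj _ s^-1%g))) /=.
apply: eq_bigr => B _; rewrite msymZ msym_xset ffunE.
have sK : s @: (s^-1%g @: B) = B.
  by rewrite -imset_comp -[RHS]imset_id; apply: eq_imset => i /=; rewrite permKV.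
rewrite sK; congr (f _ *: _); apply/ffunP=> i; rewrite !ffunE.
by rewrite -{1}sK mem_imset //; apply: perm_inj.
Qed.

Definition relabel (s : 'S_n) t := map (map s) t.

Lemma nth_relabel s t k : nth [::] (relabel s t) k = map s (nth [::] t k).
Proof. by elim: t k => [|r t IH] [|k] //=. Qed.

Lemma col_of_relabel s t i : col_of (relabel s t) (s i) = col_of t i.
Proof.
have rowE : row_of (relabel s t) (s i) = row_of t i.
  rewrite /row_of find_map; apply: eq_find => r /=.
  by rewrite mem_map //; apply: perm_inj.
by rewrite /col_of rowE nth_relabel index_map //; apply: perm_inj.
Qed.

Lemma shape_relabel s t : shape (relabel s t) = shape t.
Proof. by rewrite /shape -map_comp; apply: eq_map => r /=; rewrite size_map. Qed.

Lemma is_tableau_relabel s t : is_tableau t -> is_tableau (relabel s t).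
Proof.
move=> /andP[part perm_t]; apply/andP; split; first by rewrite shape_relabel.
rewrite /relabel -map_flatten; apply: perm_trans (perm_map s perm_t) _.
apply: uniq_perm; rewrite ?enum_uniq //.
  by rewrite map_inj_uniq ?enum_uniq //; apply: perm_inj.
move=> i; rewrite mem_enum; apply/mapP; exists (s^-1%g i); rewrite ?mem_enum //.
by rewrite permKV.
Qed.

Lemma tops_relabel (s : 'S_n) t : tops (relabel s t) = s @: tops t.
Proof.
apply/setP=> i; rewrite inE /top_row nth_relabel -[i](permKV s).
rewrite mem_map; last exact: perm_inj.
by rewrite mem_imset ?inE //; apply: perm_inj.
Qed.

(** The column stabilizer of the relabelled tableau is the conjugate by [s], and conjugation
    preserves signs. *)
Lemma tabloid_act_polytabloid (s : 'S_n) t : two_rowed t ->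
  tabloid_act s (polytabloid t) = polytabloid (relabel s t).
Proof.
move=> t2; have t2' : two_rowed (relabel s t).
  by case/andP: t2 => tt sz; rewrite /two_rowed is_tableau_relabel // size_map.
rewrite !polytabloidE // linear_sum [RHS](reindex_inj (conjg_inj s)) /=.
apply: eq_big => tau.
  rewrite !inE; apply/forallP/forallP => tau_t i.
    by rewrite -[i](permKV s) permJ !col_of_relabel.
  by have := tau_t (s i); rewrite permJ !col_of_relabel.
move=> _; rewrite /= linearZ /= tabloid_act_indicator odd_permJ tops_relabel.
congr (_ *: tabloid_vec (indicator _)); rewrite -!imset_comp.
by apply: eq_imset => i /=; rewrite permJ.
Qed.

Lemma specht_module_act rho s f : (size rho <= 2)%N ->
  specht_module rho f -> specht_module rho (tabloid_act s f).
Proof.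
move=> sz; apply: (@span_linear _ _ _ (@tabloid_act n s)) => _ [t [tt tE ->]].
have t2 : two_rowed t by rewrite /two_rowed tt -(size_map size) -/(shape t) tE.
rewrite /= tabloid_act_polytabloid //; apply: mem_span; exists (relabel s t).
by rewrite is_tableau_relabel ?shape_relabel.
Qed.

(** Elements of such a Specht module are supported on indicators, where their values are the
    coefficients of [tabloid_poly f]. *)
Lemma tabloid_poly_eq0 rho f : (size rho <= 2)%N ->
  specht_module rho f -> tabloid_poly f = 0 -> f = 0.
Proof.
move=> sz [s [gen_s fE]] f0; apply/ffunP=> u; rewrite ffunE.
case: (pickP [pred B | u == indicator B]) => [B /eqP->|none].
  by rewrite -(mcoeff_tabloid_poly f B) f0 mcoeff0.
rewrite fE sum_ffunE big_seq big1 // => p /gen_s[t [tt tE ->]].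
have t2 : two_rowed t by rewrite /two_rowed tt -(size_map size) -/(shape t) tE.
rewrite ffunE polytabloidE // sum_ffunE big1 ?scaler0 // => tau _.
by have /= := none (tau @: tops t); rewrite !ffunE => ->; rewrite scaler0.
Qed.

End SpechtModules.

(** * The isomorphism with the Specht module *)

Section SpechtIsomorphism.
Local Open Scope ring_scope.
Variables (n mu1 mu2 : nat).
Hypotheses (le_mu : (mu2 <= mu1)%N) (mu_n : (mu1 + mu2 = n)%N).
Local Notation mu := [:: mu1; mu2].

(** The natural map [psi] goes from the Specht module to R_mu; it is equivariant, injective and has
    image [U]. The required map in the other direction is its inverse [phi], whose properties follow
    from the injectivity of [psi]. *)
Lemma specht_isomorphism (S : syt n) : S \in Sigma mu ->
  isomorphic_reps (@gp_act n mu) (@tabloid_act n)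
    (span (fun x => exists T : syt n, shape (val T) = shape (val S) /\
                      x = gp_pi mu (higher_specht (val S) (val T))))
    (@specht_module n (shape (val S))).
Proof.
move=> SS; have [S2 _ le_d] := Sigma_two_rowed le_mu mu_n SS.
set U := span _; set rho := shape _; set d := #|_| in le_d.
have sz : (size rho <= 2)%N by rewrite size_map; case/andP: S2.
pose Sp := @specht_module n rho.
pose psi (f : tabloid_module n) := gp_pi mu (tabloid_poly f).
have psi_lin a f g : psi (a *: f + g) = a *: psi f + psi g by rewrite /psi !linearP.
have psi_act s f : psi (tabloid_act s f) = gp_act s (psi f).
  by rewrite /psi tabloid_poly_act gp_act_pi.
have Sp_act s f : Sp f -> Sp (tabloid_act s f) by apply: specht_module_act.
have psi_inj f g : Sp f -> Sp g -> psi f = psi g -> f = g.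
  move=> Sf Sg E; apply/eqP; rewrite -subr_eq0; apply/eqP.
  have Sfg : Sp (f - g) by apply: spanB.
  apply: (tabloid_poly_eq0 sz Sfg); apply: (specht_ideal0 le_mu mu_n).
    move: Sfg; apply: span_linear => _ [t [tt tE ->]].
    have t2 : two_rowed t by rewrite /two_rowed tt -(size_map size) -/(shape t) tE.
    apply: mem_span; exists t; split=> //; last exact: tabloid_poly_polytabloid.
    by move: tE => /eqP; rewrite eq_shape // => /eqP->.
  by apply/gp_pi_ideal; rewrite raddfB /= raddfB /=; apply/eqP; rewrite subr_eq0; apply/eqP.
have psi_U f : Sp f -> U (psi f).
  move=> Sf; apply: (@span_linear _ _ _ (gp_pi mu \o @tabloid_poly n)) Sf => _ [t [tt tE ->]].
  have t2 : two_rowed t by rewrite /two_rowed tt -(size_map size) -/(shape t) tE.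
  have cE : #|tops t| = d by move: tE => /eqP; rewrite eq_shape // => /eqP->.
  (* The tableau [t] need not be standard: each monomial of its Specht polynomial is straightened
     into standard ones of the same degree, hence of the same shape. *)
  rewrite /= tabloid_poly_polytabloid // raddf_sum; apply: span_sum => tau _.
  rewrite /= linearZ /=; apply: spanZ.
  have cB : #|tau @: tops t| = d by rewrite card_imset //; apply: perm_inj.
  have := @standard_span n mu1 mu2 le_mu mu_n (tau @: tops t); rewrite cB => /(_ le_d).
  apply: sub_span => _ [t' [t2' st' cE' ->]].
  have E : shape (val S) = shape t' by apply/eqP; rewrite eq_shape // cE'.
  rewrite (gp_pi_specht_poly le_mu mu_n SS t2' E).
  by apply/spanZ/mem_span; exists (exist (@is_standard n) t' st').
have psi_surj u : U u -> exists f, Sp f /\ psi f = u.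
  move=> [s [gen_s ->]]; rewrite big_seq; elim/big_ind: _.
  - by exists 0; split; [exact: span0|rewrite /psi !raddf0].
  - move=> _ _ [f [Sf <-]] [g [Sg <-]]; exists (f + g).
    by split; [exact: spanD|rewrite /psi !raddfD].
  move=> p /gen_s[T [E ->]]; have T2 := two_rowed_shape S2 (valP T) (ssrfun.esym E).
  exists (p.1 *: (#|row_stab (val T)|%:R *: polytabloid (val T))); split.
    apply/spanZ/spanZ/mem_span; exists (val T); split=> //.
    by case/andP: T2.
  rewrite /psi !linearZ /= tabloid_poly_polytabloid //.
  by rewrite (higher_spechtE le_mu mu_n SS T2 (ssrfun.esym E)) [X in _ = _ *: X]linearZ.
(* A preimage under [psi] in the Specht module, picked by choice, and 0 where there is none. *)
pose phi u := if pselect (exists f, Sp f /\ psi f = u) is left h then projT1 (cid h) else 0.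
have phiP u : U u -> Sp (phi u) /\ psi (phi u) = u.
  move=> Uu; rewrite /phi; case: pselect => [h|[]]; last exact: psi_surj.
  by case: cid.
split.
- by move=> s u /psi_surj[f [Sf <-]]; rewrite -psi_act; apply/psi_U/Sp_act.
- exact: Sp_act.
exists phi; split.
- move=> a u v Uu Uv; have [Su uE] := phiP u Uu; have [Sv vE] := phiP v Uv.
  have Uuv : U (a *: u + v) by apply/spanD/Uv/spanZ.
  have [Suv uvE] := phiP _ Uuv; apply: psi_inj => //; first by apply/spanD/Sv/spanZ.
  by rewrite psi_lin uvE uE vE.
- move=> s u Uu; have [Su uE] := phiP u Uu.
  have Usu : U (gp_act s u) by rewrite -uE -psi_act; apply/psi_U/Sp_act.
  have [Ssu suE] := phiP _ Usu; apply: psi_inj => //; first exact: Sp_act.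
  by rewrite psi_act suE uE.
- by move=> u v /phiP[_ {2}<-] /phiP[_ {2}<-] ->.
- by move=> u /phiP[].
- move=> f Sf; exists (psi f); first exact: psi_U.
  have [Sp_f fE] := phiP _ (psi_U f Sf).
  exact: psi_inj.
Qed.

End SpechtIsomorphism.

Theorem corollary7p24 (n mu1 mu2 : nat) (le_mu : mu2 <= mu1)
    (mu_n : mu1 + mu2 = n) :
  higher_specht_basis [:: mu1; mu2] (@Sigma n [:: mu1; mu2]).
Proof.
split; first exact: specht_basis.
exact: specht_isomorphism.
Qed.
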